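(* For every distance set $\Delta\subseteq\mathbb{R}_+$, the topological group $\mathrm{Isom}(\mathbb{U}_\Delta)$ is of type I.
   Context: A distance set is either a countable additive subsemigroup of the non-negative reals containing $0$, or the intersection $\mathcal{S}\cap[0,r]$ of such a semigroup $\mathcal{S}$ with a bounded interval $[0,r]$, where $r\in\mathcal{S}$. A $\Delta$-metric space is a metric space whose metric takes values in $\Delta$. The Urysohn $\Delta$-metric space $\mathbb{U}_\Delta$ is the unique (up to isometry) countable $\Delta$-metric space which is ultrahomogeneous (every isometry between finite subsets extends to an isometry of $\mathbb{U}_\Delta$ onto itself) and universal (every countable $\Delta$-metric space embeds isometrically into $\mathbb{U}_\Delta$). $\mathrm{Isom}(\mathbb{U}_\Delta)$ is the group of isometries of $\mathbb{U}_\Delta$ onto itself, with the Polish topology of pointwise convergence, $\mathbb{U}_\Delta$ being viewed as a discrete topological space. Unitary representations are homomorphisms into the unitary group of a complex Hilbert space, continuous for the strong operator topology. A topological group $G$ is of type I if for every unitary representation $\pi$ of $G$, the von Neumann algebra $\pi(G)''$ generated by $\pi(G)$ is of type I. *)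

(* Defs.v *)
From HB Require Import structures.
From mathcomp Require Import all_boot all_order all_algebra.
From mathcomp Require Import complex.
From mathcomp Require Import all_classical all_reals all_analysis.

Set Implicit Arguments.
Unset Strict Implicit.
Unset Printing Implicit Defensive.

Import Order.TTheory GRing.Theory Num.Theory.

Local Open Scope classical_set_scope.
Local Open Scope complex_scope.
Local Open Scope ring_scope.

HB.mixin Record isTopologicalGroup G & Group G & Topological G := {
  mulg_continuous : continuous (fun xy : G * G => (xy.1 * xy.2)%g) ;
  invg_continuous : continuous (fun x : G => x^-1%g)
}.

#[short(type="topologicalGroupType")]
HB.structure Definition TopologicalGroup :=
  {G of Group G & Topological G & isTopologicalGroup G}.

(* The inner product is linear on the left and conjugate-linear on the right,
   and the norm it induces is the given (complete) one. *)
HB.mixin Record isHilbert (R : realType) H & CompleteNormedModule R[i] H := {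
  hdot : {dot H for (@Num.conj R[i])} ;
  hdotxx : forall x : H, hdot x x = `|x| ^+ 2
}.

#[short(type="hilbertType")]
HB.structure Definition Hilbert (R : realType) :=
  {H of CompleteNormedModule R[i] H & isHilbert R H}.

Local Notation "''[' x , y ]" := (hdot x y) : ring_scope.

Section Operators.
Context {R : realType} {H : hilbertType R}.
Implicit Types (M S : set (H -> H)) (A B P Q T Z : H -> H).

Definition bounded_operator T := linear T /\ continuous T.

Definition unitary T :=
  [/\ linear T, (forall y, exists x, T x = y) &
      forall x y, '[T x, T y] = '[x, y]].

Definition commutant S : set (H -> H) :=
  [set T | bounded_operator T /\ forall A, S A -> T \o A = A \o T].

Definition projection_in M P :=
  [/\ M P, P \o P = P & forall x y, '[P x, y] = '[x, P y]].

Definition central_projection M Z :=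
  projection_in M Z /\ forall A, M A -> Z \o A = A \o Z.

(* The corner P M P is commutative. *)
Definition abelian_projection M P :=
  projection_in M P /\
  forall A B, M A -> M B ->
    (P \o A \o P) \o (P \o B \o P) = (P \o B \o P) \o (P \o A \o P).

Definition projection_le P Q := Q \o P = P.

(* Meant for a von Neumann algebra M: every nonzero central projection
   majorizes a nonzero abelian projection. *)
Definition type_I M :=
  forall Z, central_projection M Z -> Z <> cst 0 ->
    exists P, [/\ abelian_projection M P, P <> cst 0 & projection_le P Z].

End Operators.

(* Pointwise convergence on H, for the norm topology of H, is the strong
   operator topology. *)
Definition unitary_representation (R : realType) (G : topologicalGroupType)
    (H : hilbertType R) (pi : G -> {ptws H -> H}) :=
  [/\ forall g, unitary (pi g),
      pi 1%g = id,
      forall g h, pi (g * h)%g = pi g \o pi h &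
      continuous pi].

Definition type_I_group (R : realType) (G : topologicalGroupType) :=
  forall (H : hilbertType R) (pi : G -> {ptws H -> H}),
    unitary_representation pi -> type_I (commutant (commutant (range pi))).

Section DistanceSets.
Context {R : realType}.
Implicit Types (S Delta : set R).

Definition distance_semigroup S :=
  [/\ countable S, S 0, (forall x, S x -> 0 <= x) &
      forall x y, S x -> S y -> S (x + y)].

Definition distance_set Delta :=
  distance_semigroup Delta \/
  exists S r, [/\ distance_semigroup S, S r & Delta = S `&` `[0, r]].

End DistanceSets.

Section Isometries.
Context {R : realType}.

Definition isometric {U V : metricType R} (f : U -> V) :=
  forall x y, mdist (f x) (f y) = mdist x y.

Definition isometries (U : metricType R) :
    set {ptws discrete_topology U -> discrete_topology U} :=
  [set f | isometric (f : U -> U) /\ forall y, exists x, f x = y].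
Arguments isometries U : clear implicits.

(* The topology on a set_type is the subspace topology. *)
Definition Isom (U : metricType R) : Type := set_type (isometries U).

HB.instance Definition _ (U : metricType R) :=
  Topological.copy (Isom U) (set_type (isometries U)).

Section Group.
Variable U : metricType R.
Implicit Types f g h : Isom U.

Definition isom_fun f : U -> U := set_val f.

Lemma isom_funP f : isometric (isom_fun f).
Proof. by have [] := set_valP f. Qed.

Lemma isom_fun_surj f y : exists x, isom_fun f x = y.
Proof. by have [_] := set_valP f; exact. Qed.

Lemma isom_fun_inj f : injective (isom_fun f).
Proof.
move=> x y fxy; apply: (@mdist_positivity R).
by rewrite -(isom_funP f) fxy mdistxx.
Qed.

Lemma isom_eqP f g : isom_fun f =1 isom_fun g -> f = g.
Proof. by move=> fg; apply: val_inj; apply/funext. Qed.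

Definition mk_isom (f : U -> U) (fP : isometries U f) : Isom U :=
  SigSub (mem_set fP).

Lemma isometries_id : isometries U id.
Proof. by split=> // y; exists y. Qed.

Lemma isometries_comp f g : isometries U (isom_fun f \o isom_fun g).
Proof.
split=> [x y|y] /=; first by rewrite !isom_funP.
have [z <-] := isom_fun_surj f y; have [x <-] := isom_fun_surj g z.
by exists x.
Qed.

Definition isom_inv_fun f (y : U) : U := sval (cid (isom_fun_surj f y)).

Lemma isom_inv_funK f : cancel (isom_inv_fun f) (isom_fun f).
Proof. by move=> y; rewrite /isom_inv_fun; case: cid. Qed.

Lemma isometries_inv f : isometries U (isom_inv_fun f).
Proof.
split=> [x y|y]; first by rewrite -(isom_funP f) !isom_inv_funK.
by exists (isom_fun f y); apply: (@isom_fun_inj f); rewrite isom_inv_funK.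
Qed.

Definition isom1 := mk_isom isometries_id.
Definition isom_mul f g := mk_isom (isometries_comp f g).
Definition isom_inv f := mk_isom (isometries_inv f).

Fact isom_mulA : associative isom_mul.
Proof. by move=> f g h; apply: isom_eqP. Qed.

Fact isom_mul1 : left_id isom1 isom_mul.
Proof. by move=> f; apply: isom_eqP. Qed.

Fact isom_mulr1 : right_id isom1 isom_mul.
Proof. by move=> f; apply: isom_eqP. Qed.

Fact isom_mulVr : right_inverse isom1 isom_inv isom_mul.
Proof. by move=> f; apply: isom_eqP => x; exact: isom_inv_funK. Qed.

Fact isom_mulV : left_inverse isom1 isom_inv isom_mul.
Proof.
move=> f; apply: isom_eqP => x; apply: (@isom_fun_inj f).
exact: isom_inv_funK.
Qed.

HB.instance Definition _ := @isGroup.Build (Isom U)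
  isom1 isom_inv isom_mul isom_mulA isom_mul1 isom_mulr1 isom_mulV isom_mulVr.

Lemma nbhs_isom (f : Isom U) (x : U) :
  \forall g \near f, isom_fun g x = isom_fun f x.
Proof.
have cval : continuous (set_val : set_type (isometries U) ->
    {ptws discrete_topology U -> discrete_topology U}).
  exact: initial_continuous.
have cx := @proj_continuous (discrete_topology U)
  (fun=> discrete_topology U) x (set_val f).
exact: (continuous_comp (cval f) cx) _ (discrete_set1 _).
Qed.

Lemma continuous_to_isom (T : topologicalType) (F : T -> Isom U) :
  (forall t x, \forall s \near t, isom_fun (F s) x = isom_fun (F t) x) ->
  continuous F.
Proof.
move=> FP; apply: (@continuous_comp_initial _ _ _ set_val) => t.
apply/(@pointwise_cvgP (discrete_topology U) (discrete_topology U)) => x.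
apply/discrete_cvg; exact: FP.
Qed.

Fact isom_mul_continuous :
  continuous (fun fg : Isom U * Isom U => (fg.1 * fg.2)%g).
Proof.
apply: continuous_to_isom => -[f g] x /=.
exists ([set h | isom_fun h (isom_fun g x) = isom_fun f (isom_fun g x)],
        [set h | isom_fun h x = isom_fun g x]).
  by split; exact: nbhs_isom.
move=> [h k] /= [hE kE].
by change (isom_fun h (isom_fun k x) = isom_fun f (isom_fun g x)); rewrite kE.
Qed.

Fact isom_inv_continuous : continuous (fun f : Isom U => f^-1%g).
Proof.
apply: continuous_to_isom => f x.
have := nbhs_isom f (isom_inv_fun f x); apply: filterS => g.
rewrite isom_inv_funK => gx; apply: (@isom_fun_inj g).
by rewrite [LHS]isom_inv_funK -[LHS]gx.
Qed.

HB.instance Definition _ := isTopologicalGroup.Build (Isom U)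
  isom_mul_continuous isom_inv_continuous.

End Group.

Definition metric_space_in (Delta : set R) (U : metricType R) :=
  forall x y : U, Delta (mdist x y).

Definition ultrahomogeneous (U : metricType R) :=
  forall (A : set U) (f : U -> U), finite_set A ->
    {in A &, forall x y, mdist (f x) (f y) = mdist x y} ->
    exists g : Isom U, {in A, isom_fun g =1 f}.

Definition universal (Delta : set R) (U : metricType R) :=
  forall V : metricType R, countable [set: V] -> metric_space_in Delta V ->
    exists f : V -> U, isometric f.

Definition urysohn_space (Delta : set R) (U : metricType R) :=
  [/\ countable [set: U], metric_space_in Delta U,
      ultrahomogeneous U & universal Delta U].

End Isometries.

(* Main.v *)
From HB Require Import structures.
Require Import Defs.
From mathcomp Require Import all_boot all_order all_algebra.
From mathcomp Require Import complex ring lra.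
From mathcomp Require Import all_classical all_reals all_analysis.

(** Let G be the isometry group of the Urysohn space U, let pi be a unitary
representation of G on H, M the von Neumann algebra that it generates, and Z a
nonzero central projection of M.  For a finite subset A of U let G_A be its
pointwise stabilizer in G and H_A the closed subspace of vectors fixed by G_A;
the projection p_A onto H_A belongs to M.

Since the groups G_A form a basis of neighbourhoods of 1, some Z H_A is nonzero
([exists_fixed]); choose such an A with the fewest points.  The heart of the
proof is that U is dissociated: a vector xi of H_A is orthogonal to H_B as soon
as its orbit under G_(A cap B) has 0 in its closed convex hull
([orthogonal_fixed]).  By minimality this applies to vectors of Z H_A whenever B
does not contain A.  Hence, with P = Z p_A, the compression P pi(g) P vanishes
unless g permutes A, while pi(g) P = P pi(g) depends on the permutation of A
only when g does permute A.  So the operators P pi(g) P span a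
finite-dimensional *-algebra, and such an algebra contains a minimal projection q
([minimal_projection_below]).  All the compressions q pi(g) q are then scalar
multiples of q; as T v lies in the closed span of the orbit of v for every T in
M, so are all q T q with T in M ([minimal_abelian]).  Thus q is a nonzero abelian
projection below Z.

For the orthogonality, write t(rho) for the inner product of pi(g) xi and
pi(h) xi when the points a of the copy g A and b of the copy h A lie at distance
rho a b; by homogeneity it depends on rho only.  Suppose that rho <= rho' and
rho' a c <= rho a b + rho b c.  Then there are arbitrarily many copies of A whose
pairwise distances are rho or rho' in any prescribed symmetric pattern.  Using the
bipartite pattern and its complement, the nonnegativity of the squared norm of an
alternating sum of vectors pi(g_i) xi gives t(rho) = t(rho') ([gram_eq]).  This
moves rho by a factor two, which is enough to go step by step from the free
amalgamation distance over B to the one over A cap B.  The first one controls the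
inner product of xi with H_B, because there are arbitrarily many copies of A which
are free from each other over B and look the same from B ([dot_le_gram]).  For
the second one t is as small as wished, because a copy of A can be taken free over
A cap B from finitely many translates of A, some convex combination of the
corresponding translates of xi being nearly 0 ([gram_small]). *)

Set Implicit Arguments.
Unset Strict Implicit.
Unset Printing Implicit Defensive.

Import Order.TTheory GRing.Theory Num.Theory.
Import numFieldNormedType.Exports.

Local Open Scope classical_set_scope.
Local Open Scope complex_scope.
Local Open Scope ring_scope.

Local Notation "''[' x , y ]" := (hdot x y) : ring_scope.

(** * Convexity and projections in a Hilbert space *)

Section Hilbert.
Context {R : realType} {H : hilbertType R}.
Implicit Types (x y z u v w : H) (a b : R[i]).

Lemma dotDl x y z : '[x + y, z] = '[x, z] + '[y, z].
Proof. by rewrite linearDl. Qed.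

Lemma dotZl a x y : '[a *: x, y] = a * '[x, y].
Proof. by rewrite linearZl_LR. Qed.

Lemma dotDr x y z : '[x, y + z] = '[x, y] + '[x, z].
Proof. by rewrite linearD. Qed.

Lemma dotZr a x y : '[x, a *: y] = a^* * '[x, y].
Proof. by rewrite linearZr_LR. Qed.

Lemma dotC x y : '[x, y] = ('[y, x])^*.
Proof. by rewrite hermC expr0 mul1r. Qed.

Lemma dot0l y : '[0, y] = 0.
Proof. by rewrite linear0l. Qed.

Lemma dotNl x y : '[- x, y] = - '[x, y].
Proof. by rewrite linearNl. Qed.

Lemma dotNr x y : '[x, - y] = - '[x, y].
Proof. by rewrite linearN. Qed.

Lemma dotBl x y z : '[x - y, z] = '[x, z] - '[y, z].
Proof. by rewrite dotDl dotNl. Qed.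

(** Convexity arguments see only the real part of the inner product, and the
squared norm spares all square roots: inequalities then live in R. *)
Definition rdot x y : R := complex.Re '[x, y].

Definition sqnorm x : R := rdot x x.

Lemma ReD a b : complex.Re (a + b) = complex.Re a + complex.Re b.
Proof. by case: a b => [? ?] [? ?]. Qed.

Lemma Re_conj a : complex.Re (a^*) = complex.Re a.
Proof. by case: a. Qed.

Lemma dotxx x : '[x, x] = (sqnorm x)%:C.
Proof. by rewrite /sqnorm /rdot RRe_real // hdotxx realX // normr_real. Qed.

Lemma rdotC x y : rdot x y = rdot y x.
Proof. by rewrite /rdot dotC Re_conj. Qed.

Lemma rdotDl x y z : rdot (x + y) z = rdot x z + rdot y z.
Proof. by rewrite /rdot dotDl ReD. Qed.

Lemma rdotZl (t : R) x y : rdot (t%:C *: x) y = t * rdot x y.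
Proof. by rewrite /rdot dotZl; case: '[x, y] => c d /=; rewrite mul0r subr0. Qed.

Lemma rdotDr x y z : rdot z (x + y) = rdot z x + rdot z y.
Proof. by rewrite ![rdot z _]rdotC rdotDl. Qed.

Lemma rdotZr (t : R) x y : rdot y (t%:C *: x) = t * rdot y x.
Proof. by rewrite ![rdot y _]rdotC rdotZl. Qed.

Lemma rdotNl x y : rdot (- x) y = - rdot x y.
Proof. by rewrite /rdot dotNl; case: '[x, y]. Qed.

Lemma rdotNr x y : rdot y (- x) = - rdot y x.
Proof. by rewrite ![rdot y _]rdotC rdotNl. Qed.

Lemma rdot0l x : rdot 0 x = 0.
Proof. by rewrite /rdot dot0l. Qed.

Lemma sqr_normE x : `|x| ^+ 2 = (sqnorm x)%:C.
Proof. by rewrite -hdotxx dotxx. Qed.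

Lemma sqnorm_ge0 x : 0 <= sqnorm x.
Proof. by rewrite -ler0c -sqr_normE exprn_ge0. Qed.

Lemma sqnorm_eq0 x : sqnorm x = 0 -> x = 0.
Proof. by move=> x0; apply/eqP; rewrite -normr_eq0 -sqrf_eq0 sqr_normE x0. Qed.

Lemma sqnormD x y : sqnorm (x + y) = sqnorm x + 2 * rdot x y + sqnorm y.
Proof. rewrite /sqnorm rdotDl !rdotDr [rdot y x]rdotC; lra. Qed.

Lemma sqnormN x : sqnorm (- x) = sqnorm x.
Proof. by rewrite /sqnorm rdotNl rdotNr opprK. Qed.

Lemma sqnormB x y : sqnorm (x - y) = sqnorm x - 2 * rdot x y + sqnorm y.
Proof. by rewrite sqnormD sqnormN rdotNr; lra. Qed.

Lemma sqnormZ (t : R) x : sqnorm (t%:C *: x) = t ^+ 2 * sqnorm x.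
Proof. by rewrite /sqnorm rdotZl rdotZr; lra. Qed.

Lemma sqnorm_distC x y : sqnorm (x - y) = sqnorm (y - x).
Proof. by rewrite -sqnormN opprB. Qed.

Lemma sqnormD_le x y : sqnorm (x + y) <= 2 * sqnorm x + 2 * sqnorm y.
Proof. have := sqnorm_ge0 (x - y); rewrite sqnormB sqnormD; lra. Qed.

Lemma rdot_CauchySchwarz x y : rdot x y ^+ 2 <= sqnorm x * sqnorm y.
Proof.
have y0 := sqnorm_ge0 y; have [{}y0|yN0] := ltP 0 (sqnorm y); last first.
  have -> : y = 0 by apply: sqnorm_eq0; lra.
  by rewrite rdotC rdot0l /sqnorm rdot0l; lra.
have := sqnorm_ge0 ((sqnorm y)%:C *: x + (- rdot x y)%:C *: y).
rewrite sqnormD !sqnormZ rdotZl rdotZr => h.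
have : 0 <= sqnorm y * (sqnorm x * sqnorm y - rdot x y ^+ 2) by nra.
by rewrite pmulr_rge0 // subr_ge0.
Qed.

Lemma sub_midpoint x y z : x - (2^-1 : R)%:C *: (y + z) =
  (2^-1 : R)%:C *: ((x - y) + (x - z)).
Proof.
rewrite addrACA -opprD [RHS]scalerDr scalerN; congr (_ - _).
have half2 : (2^-1 : R) + 2^-1 = 1 by lra.
by rewrite scalerDr -scalerDl -rmorphD /= half2 scale1r.
Qed.

(** Topological closedness, in the form that fits estimates of squared norms. *)
Definition norm_closed (Q : set H) :=
  forall x, (forall e : R, 0 < e -> exists2 y, Q y & sqnorm (x - y) < e) -> Q x.

(** For closed sets this amounts to convexity. *)
Definition midconvex (Q : set H) :=
  forall x y, Q x -> Q y -> Q ((2^-1 : R)%:C *: (x + y)).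

Lemma sqr_le_exists (e : R) : 0 < e -> exists2 d : R, 0 < d & d ^+ 2 <= e.
Proof.
move=> e0; exists (Num.min 1 e); first by rewrite lt_min ltr01.
have := ge_min e 1 e; have := ge_min 1 1 e.
have: 0 < Num.min 1 e by rewrite lt_min ltr01.
rewrite !lexx orbT /=; nra.
Qed.

Lemma sqnorm_lt_norm (e : R) x : 0 < e -> (sqnorm x < e ^+ 2) = (`|x| < e%:C).
Proof.
move=> e0; rewrite -ltcR -sqr_normE rmorphXn /= ltr_pXn2r //= ?nnegrE ?ler0c//.
exact: ltW.
Qed.

Lemma sqnorm_complete (u : nat -> H) :
  (forall e : R, 0 < e -> exists N, forall m n, (N <= m)%N -> (N <= n)%N ->
     sqnorm (u m - u n) < e) ->
  exists l, forall e : R, 0 < e -> exists N, forall n, (N <= n)%N ->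
    sqnorm (l - u n) < e.
Proof.
move=> uC.
have : cvg (u @ \oo).
  apply: cauchy_cvg; apply/cauchyP => -[e f] /= ef0.
  have /andP[/eqP/esym e_im e0] : (f == 0) && (0 < e) by move: ef0; rewrite ltcE /=.
  subst f.
  have [N uN] := uC (e ^+ 2) (exprn_gt0 2 e0).
  exists (u N); exists N => // n /= Nn.
  rewrite -ball_normE /= -sqnorm_lt_norm //; exact: uN.
move=> /cvg_ex[l ul]; exists l => e e0.
have [e1 e10 ee1] := sqr_le_exists e0.
move/cvgrPdist_lt: ul => /(_ e1%:C); rewrite ltcR => /(_ e10)[N _ uN].
exists N => n Nn; apply: lt_le_trans ee1; rewrite sqnorm_lt_norm //; exact: uN.
Qed.

Lemma parallelogram x y : sqnorm (x - y) =
  2 * sqnorm x + 2 * sqnorm y - 4 * sqnorm ((2^-1 : R)%:C *: (x + y)).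
Proof. by rewrite sqnormZ sqnormB sqnormD; field. Qed.

(** A minimizing sequence is Cauchy, because the parallelogram identity bounds
its differences by means of the norms of midpoints, which lie in Q. *)
Lemma min_norm (Q : set H) : norm_closed Q -> midconvex Q -> Q !=set0 ->
  exists2 m, Q m & forall y, Q y -> sqnorm m <= sqnorm y.
Proof.
move=> Qc Qm [q Qq].
pose D := [set sqnorm y | y in Q].
have Dinf : has_inf D.
  split; first by exists (sqnorm q); exists q.
  by exists 0 => _ [y _ <-]; exact: sqnorm_ge0.
have infD y : Q y -> inf D <= sqnorm y.
  by move=> Qy; apply: ge_inf; [case: Dinf | exists y].
have uP n : exists y, Q y /\ sqnorm y < inf D + n.+1%:R^-1.
  have n0 : 0 < n.+1%:R^-1 :> R by rewrite invr_gt0.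
  have [_ [y Qy <-] yD] := inf_adherent n0 Dinf.
  by exists y.
have [u uQ] := choice uP.
have inv_small (e : R) : 0 < e -> exists N, forall n, (N <= n)%N -> n.+1%:R^-1 < e.
  move=> e0; have [N _ NP] := near_infty_natSinv_lt (PosNum e0).
  by exists N => n Nn; exact: NP.
have [l ul] : exists l, forall e : R, 0 < e ->
    exists N, forall n, (N <= n)%N -> sqnorm (l - u n) < e.
  apply: sqnorm_complete => e e0.
  have e4 : 0 < e / 4 by lra.
  have [N NP] := inv_small _ e4.
  exists N => m n Nm Nn; rewrite parallelogram.
  have := infD _ (Qm _ _ (uQ m).1 (uQ n).1).
  have := (uQ m).2; have := (uQ n).2; have := NP _ Nm; have := NP _ Nn.
  move: (n.+1%:R^-1) (m.+1%:R^-1) => a b; lra.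
exists l.
  apply: Qc => e e0; have [N NP] := ul e e0.
  by exists (u N); [case: (uQ N) | exact: NP].
move=> y Qy; apply: le_trans (infD _ Qy).
rewrite leNgt; apply/negP => lt_l.
pose d := sqnorm l - inf D.
have d0 : 0 < d by rewrite /d; lra.
have l0 := sqnorm_ge0 l.
(* For [sqnorm (l - u n) < e], the first bound forces [2 * rdot l (l - u n)] to
   exceed [d / 2], which the second one forbids by Cauchy-Schwarz. *)
pose e := Num.min (d / 2) (d ^+ 2 / (64 * (sqnorm l + 1))).
have e0 : 0 < e.
  rewrite lt_min divr_gt0 //= divr_gt0 ?exprn_gt0 //; lra.
have e1 : e <= d / 2 by rewrite ge_min lexx.
have e2 : e * (64 * (sqnorm l + 1)) <= d ^+ 2.
  by rewrite -ler_pdivlMr ?ge_min ?lexx ?orbT //; lra.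
have [N1 N1P] := ul e e0; have [N2 N2P] := inv_small _ e0.
have n1 := N1P _ (leq_maxl N1 N2); have inv_lt := N2P _ (leq_maxr N1 N2).
set n := maxn N1 N2 in n1 inv_lt.
have := (uQ n).2.
have -> : sqnorm (u n) = sqnorm l - 2 * rdot l (l - u n) + sqnorm (l - u n).
  by rewrite -sqnormB opprB addrC subrK.
have := rdot_CauchySchwarz l (l - u n); have := sqnorm_ge0 (l - u n).
move: (n.+1%:R^-1) inv_lt => a ae.
set r := rdot _ _; set v := sqnorm (l - u n) in n1 *; move=> v0 cs h.
have r1 : d / 4 < r by rewrite /d in e1 *; lra.
have : d ^+ 2 / 16 < r ^+ 2 by nra.
have : sqnorm l * v <= sqnorm l * e by nra.
nra.
Qed.

Lemma min_norm_uniq (Q : set H) m m' : midconvex Q -> Q m -> Q m' ->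
  (forall y, Q y -> sqnorm m <= sqnorm y) -> sqnorm m' = sqnorm m -> m' = m.
Proof.
move=> Qc Qm Qm' mP mm'; apply/eqP; rewrite -subr_eq0; apply/eqP.
apply: sqnorm_eq0; apply: le_anti; rewrite sqnorm_ge0 andbT parallelogram.
have := mP _ (Qc _ _ Qm' Qm); lra.
Qed.

(** The closed convex hull, encoded by what it is used for: the closed convex
properties shared by all points of A hold on it. *)
Definition hull (A : set H) : set H := fun x =>
  forall Q : set H, norm_closed Q -> midconvex Q -> A `<=` Q -> Q x.

Lemma hull_norm_closed A : norm_closed (hull A).
Proof.
move=> x xA Q Qc Qm AQ; apply: (Qc) => e e0; have [y yA xy] := xA e e0.
by exists y => //; apply: (yA Q).
Qed.

Lemma hull_midconvex A : midconvex (hull A).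
Proof. by move=> x y xA yA Q Qc Qm AQ; apply: (Qm); [apply: (xA Q)|apply: (yA Q)]. Qed.

Lemma sub_hull A : A `<=` hull A.
Proof. by move=> x Ax Q _ _; exact. Qed.

Definition isometry_op (T : H -> H) := linear T /\ forall x, sqnorm (T x) = sqnorm x.

Lemma linear_opD (T : H -> H) : linear T -> forall x y, T (x + y) = T x + T y.
Proof. by move=> lT x y; have := lT 1 x y; rewrite !scale1r. Qed.

Lemma linear_op0 (T : H -> H) : linear T -> T 0 = 0.
Proof. by move=> lT; apply: (addrI (T 0)); rewrite -linear_opD ?addr0. Qed.

Lemma linear_opZ (T : H -> H) : linear T -> forall a x, T (a *: x) = a *: T x.
Proof. by move=> lT a x; have := lT a x 0; rewrite (linear_op0 lT) !addr0. Qed.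

Lemma linear_opN (T : H -> H) : linear T -> forall x, T (- x) = - T x.
Proof. by move=> lT x; rewrite -scaleN1r linear_opZ ?scaleN1r. Qed.

Lemma linear_opB (T : H -> H) : linear T -> forall x y, T (x - y) = T x - T y.
Proof. by move=> lT x y; rewrite (linear_opD lT) (linear_opN lT). Qed.

(** Continuity at 0, which for linear maps is boundedness. *)
Definition continuous_at0 (T : H -> H) :=
  forall e : R, 0 < e -> exists2 d : R, 0 < d &
    forall x, sqnorm x < d -> sqnorm (T x) < e.

Lemma continuous_at0_le (T : H -> H) :
  (forall x, sqnorm (T x) <= sqnorm x) -> continuous_at0 T.
Proof. by move=> Tle e e0; exists e => // x; exact: le_lt_trans. Qed.

Lemma norm_closed_preimage (T : H -> H) (Q : set H) : linear T ->
  continuous_at0 T -> norm_closed Q -> norm_closed (T @^-1` Q).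
Proof.
move=> lT Tc Qc x xP; apply: Qc => e e0; have [d d0 dP] := Tc e e0.
have [y Qy xy] := xP d d0.
by exists (T y) => //; rewrite -linear_opB //; exact: dP.
Qed.

Lemma bounded_operatorP (T : H -> H) :
  bounded_operator T <-> linear T /\ continuous_at0 T.
Proof.
split=> -[lT Tc]; split=> //; last first.
  move=> x; apply/cvgrPdist_lt => -[e f]; rewrite ltcE /= => /andP[/eqP -> e0].
  have [d d0 dP] := Tc (e ^+ 2) (exprn_gt0 2 e0).
  have [d1 d10 dd1] := sqr_le_exists d0.
  apply/nbhs_ballP; exists d1%:C; first by rewrite /= ltcR.
  move=> y; rewrite -ball_normE /= -linear_opB // -!sqnorm_lt_norm // => xy.
  by apply: dP; apply: lt_le_trans dd1.
move=> e e0; have [e1 e10 ee1] := sqr_le_exists e0.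
have /cvgrPdist_lt/(_ e1%:C) := Tc 0; rewrite ltcR => /(_ e10).
move=> /nbhs_ballP[[d f]] /=; rewrite ltcE /= => /andP[/eqP f0 d0] dP.
move: dP; rewrite f0 => dP.
exists (d ^+ 2) => [|x]; first exact: exprn_gt0.
rewrite sqnorm_lt_norm // => xd; apply: lt_le_trans ee1; rewrite sqnorm_lt_norm //.
have /= := dP x; rewrite -ball_normE /= sub0r normrN => /(_ xd).
by rewrite (linear_op0 lT) sub0r normrN.
Qed.

Lemma midconvex_preimage (T : H -> H) (Q : set H) : linear T ->
  midconvex Q -> midconvex (T @^-1` Q).
Proof.
move=> lT Qm x y Qx Qy; rewrite /preimage /= linear_opZ // linear_opD //.
exact: Qm.
Qed.

(** The closed convex hull of an orbit is invariant, and isometries preserve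
norms, so its unique point of least norm is fixed: this is the ergodic theorem of
Alaoglu and Birkhoff. *)
Lemma fixed_in_hull (S : set (H -> H)) x :
  S id -> (forall s, S s -> isometry_op s) ->
  (forall s t, S s -> S t -> S (s \o t)) ->
  exists2 m, (forall s, S s -> s m = m) & hull [set s x | s in S] m.
Proof.
move=> S1 Si SM.
have [|||m hm mP] := @min_norm (hull [set s x | s in S]).
- exact: hull_norm_closed.
- exact: hull_midconvex.
- by exists x; apply: sub_hull; exists id.
exists m => // s Ss; have [ls ns] := Si s Ss.
apply: (@min_norm_uniq (hull [set s x | s in S])) => //.
- exact: hull_midconvex.
- apply: (hm (s @^-1` hull [set s x | s in S])).
  + apply: norm_closed_preimage => //; last exact: hull_norm_closed.
    by apply: continuous_at0_le => y; rewrite ns.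
  + apply: midconvex_preimage => //; exact: hull_midconvex.
  + move=> _ [t St <-]; apply: sub_hull; exists (s \o t) => //; exact: SM.
Qed.

Definition linear_subspace (V : set H) :=
  V 0 /\ forall a x y, V x -> V y -> V (a *: x + y).

Definition orthogonal_projection (V : set H) (p : H -> H) :=
  forall x, V (p x) /\ forall v, V v -> '[x - p x, v] = 0.

(** The vector x - p x is the one of least norm in the closed convex set x + V.
If it were not orthogonal to some v in V, moving it along v would shorten it. *)
Lemma projection_exists (V : set H) : linear_subspace V -> norm_closed V ->
  exists p, orthogonal_projection V p.
Proof.
move=> [V0 VZD] Vc.
have VD x y : V x -> V y -> V (x + y) by move=> Vx; rewrite -[x]scale1r; exact: VZD.
have VZ a x : V x -> V (a *: x) by move=> Vx; rewrite -[_ *: _]addr0; exact: VZD.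
suff /choice[p pP] : forall x, exists y, V y /\ forall v, V v -> '[x - y, v] = 0.
  by exists p.
move=> x.
have [|||m Vm mP] := @min_norm [set y | V (x - y)].
- move=> y yP; apply: Vc => e e0; have [z Vz yz] := yP e e0.
  by exists (x - z) => //; rewrite opprB addrC addrA subrK sqnorm_distC.
- move=> y z Vy Vz /=.
  rewrite sub_midpoint.
  by apply: VZ; exact: VD.
- by exists x; rewrite /= subrr.
have orth v : V v -> rdot m v = 0.
  move=> Vv; apply/eqP/negPn/negP => mv0.
  have v0 : 0 <= sqnorm v := sqnorm_ge0 v.
  (* The minimum of [sqnorm (m + t v)] is at [- rdot m v / sqnorm v]; the 1 in the
     denominator only avoids the case [v = 0]. *)
  pose t := - rdot m v / (sqnorm v + 1).
  have := mP (m + t%:C *: v); rewrite /= opprD addrA => /(_ (VD _ _ Vm _)).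
  rewrite -scaleN1r => /(_ (VZ _ _ (VZ _ _ Vv))).
  rewrite sqnormD sqnormZ rdotZr.
  have -> : rdot m v = - t * (sqnorm v + 1).
    by rewrite /t; field; apply: lt0r_neq0; lra.
  have t0 : t != 0.
    rewrite /t mulf_neq0 ?oppr_eq0 //= invr_neq0 //.
    by apply: lt0r_neq0; lra.
  have : 0 < t ^+ 2 by rewrite exprn_even_gt0.
  nra.
exists (x - m); split => // v Vv; rewrite opprB addrC subrK.
have := orth _ Vv; have := orth _ (VZ 'i%C _ Vv); rewrite /rdot dotZr.
case: '[m, v] => c d /=; rewrite mul0r mulN1r sub0r opprK => -> ->.
by [].
Qed.

Section Projection.
Variables (V : set H) (p : H -> H).
Hypotheses (Vs : linear_subspace V) (pP : orthogonal_projection V p).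

Lemma subspaceB x y : V x -> V y -> V (x - y).
Proof.
by move=> Vx Vy; rewrite -[- y]scaleN1r addrC; apply: Vs.2.
Qed.

Lemma dot_eq0 x : '[x, x] = 0 -> x = 0.
Proof. by rewrite hdotxx => /eqP; rewrite sqrf_eq0 normr_eq0 => /eqP. Qed.

Lemma proj_uniq x y : V y -> (forall v, V v -> '[x - y, v] = 0) -> p x = y.
Proof.
move=> Vy yP; have [Vp pxP] := pP x.
apply/eqP; rewrite -subr_eq0; apply/eqP; apply: dot_eq0.
have Vv := subspaceB Vp Vy.
have -> : p x - y = (x - y) - (x - p x) by rewrite opprB [RHS]addrC addrA subrK.
by rewrite dotBl yP ?pxP ?subrr // opprB [x - y + _]addrC addrA subrK.
Qed.

Lemma proj_id x : V x -> p x = x.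
Proof. by move=> Vx; apply: proj_uniq => // v _; rewrite subrr dot0l. Qed.

Lemma proj_linear : linear p.
Proof.
move=> a x y; apply: proj_uniq => [|v Vv]; first by apply: Vs.2; exact: (pP _).1.
rewrite opprD addrACA dotDl (pP y).2 // addr0 -scalerBr dotZl (pP x).2 //.
by rewrite mulr0.
Qed.

Lemma proj_self_adjoint x y : '[p x, y] = '[x, p y].
Proof.
have h u v : '[p u, v - p v] = 0.
  by rewrite dotC (pP v).2 ?rmorph0 //; exact: (pP _).1.
have -> : '[p x, y] = '[p x, p y].
  by rewrite -[y in LHS](subrK (p y)) dotDr h add0r.
by rewrite -[x in RHS](subrK (p x)) dotDl (pP x).2 ?add0r //; exact: (pP _).1.
Qed.

Lemma proj_sqnorm x : sqnorm (p x) <= sqnorm x.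
Proof.
rewrite -[x in leRHS](subrK (p x)) sqnormD /rdot (pP x).2; last exact: (pP _).1.
by have := sqnorm_ge0 (x - p x); rewrite /= mulr0 addr0 lerDr.
Qed.

Lemma proj_bounded : bounded_operator p.
Proof.
apply/bounded_operatorP; split; first exact: proj_linear.
by apply: continuous_at0_le; exact: proj_sqnorm.
Qed.

Lemma proj_commute (T : H -> H) : linear T ->
  (forall x, V x -> V (T x)) ->
  (forall x, (forall v, V v -> '[x, v] = 0) -> forall v, V v -> '[T x, v] = 0) ->
  forall x, p (T x) = T (p x).
Proof.
move=> lT TV TVo x; apply: proj_uniq; first by apply: TV; exact: (pP _).1.
by move=> v Vv; rewrite -linear_opB // TVo // => w; exact: (pP _).2.
Qed.

End Projection.

End Hilbert.

(** * Closed half-spaces, bounded operators and commutants *)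

Section BoundedOperators.
Context {R : realType} {H : hilbertType R}.
Implicit Types (x y z v f : H) (T S : H -> H).

Lemma norm_closed_rdot_ge f (c : R) : norm_closed [set v : H | c <= rdot v f].
Proof.
move=> x xP /=; rewrite leNgt; apply/negP => lt_c.
have f0 := sqnorm_ge0 f.
have e0 : 0 < (c - rdot x f) ^+ 2 / (sqnorm f + 1).
  by rewrite divr_gt0 ?exprn_gt0 ?subr_gt0 //; lra.
have [y yc] := xP _ e0; rewrite ltr_pdivlMr; last by lra.
have := rdot_CauchySchwarz (x - y) f; rewrite rdotDl rdotNl.
have := sqnorm_ge0 (x - y); rewrite /= in yc; nra.
Qed.

Lemma midconvex_rdot_ge f (c : R) : midconvex [set v : H | c <= rdot v f].
Proof. by move=> x y /= cx cy; rewrite rdotZl rdotDl; lra. Qed.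

Lemma hull_rdot_ge (A : set H) f (c : R) :
  (forall v, A v -> c <= rdot v f) -> forall v, hull A v -> c <= rdot v f.
Proof.
move=> Ac v hv; apply: (hv [set v | c <= rdot v f]).
- exact: norm_closed_rdot_ge.
- exact: midconvex_rdot_ge.
- exact: Ac.
Qed.

Lemma hull_rdot_eq (A : set H) f (c : R) :
  (forall v, A v -> rdot v f = c) -> forall v, hull A v -> rdot v f = c.
Proof.
move=> Ac v hv; apply/eqP; rewrite eq_le; apply/andP; split.
  by rewrite -lerN2 -rdotNr; apply: hull_rdot_ge hv => w /Ac <-; rewrite rdotNr.
by apply: hull_rdot_ge hv => w /Ac ->.
Qed.

Lemma norm_closed_rdot_eq f (c : R) : norm_closed [set v : H | rdot v f = c].
Proof.
move=> x xP /=; apply/eqP; rewrite eq_le -lerN2 -rdotNr.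
apply/andP; split; apply: norm_closed_rdot_ge => e /xP[y] /= yc xy; exists y => //=.
  by rewrite rdotNr yc.
by rewrite yc.
Qed.

Lemma dot_eq0P x y : '[x, y] = 0 <-> rdot x y = 0 /\ rdot x ('i%C *: y) = 0.
Proof.
rewrite /rdot dotZr; case: '[x, y] => a b /=.
rewrite mul0r mulN1r sub0r opprK; split=> [[-> ->]//|[-> ->]//].
Qed.

Lemma norm_closed_orthogonal f : norm_closed [set v : H | '[v, f] = 0].
Proof.
move=> x xP; apply/dot_eq0P; split; apply: norm_closed_rdot_eq =>
  e /xP[y] /dot_eq0P[y1 y2] xy;
  by exists y.
Qed.

Lemma bounded_id : bounded_operator (id : H -> H).
Proof. by apply/bounded_operatorP; split=> //; exact: continuous_at0_le. Qed.

Lemma bounded_comp S T : bounded_operator S -> bounded_operator T ->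
  bounded_operator (S \o T).
Proof.
move=> /bounded_operatorP[lS cS] /bounded_operatorP[lT cT].
apply/bounded_operatorP; split=> [a x y /=|e e0].
  by rewrite (linear_opD lT) (linear_opZ lT) (linear_opD lS) (linear_opZ lS).
have [d1 d10 d1P] := cS e e0; have [d2 d20 d2P] := cT d1 d10.
by exists d2 => // x /d2P/d1P.
Qed.

Lemma sqnormZC (c : R[i]) x : (sqnorm (c *: x))%:C = `|c| ^+ 2 * (sqnorm x)%:C.
Proof. by rewrite -!sqr_normE normrZ exprMn. Qed.

Lemma continuous_at0_scale (c : R[i]) : continuous_at0 (fun x : H => c *: x).
Proof.
have [k k0 ck] : exists2 k : R, 0 < k & `|c| ^+ 2 <= k%:C.
  have h : (complex.Re (`|c| ^+ 2))%:C = `|c| ^+ 2.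
    by rewrite RRe_real // realX // normr_real.
  have h0 : 0 <= complex.Re (`|c| ^+ 2) by rewrite -ler0c h exprn_ge0.
  exists (complex.Re (`|c| ^+ 2) + 1); first by lra.
  by rewrite -[leLHS]h lecR; lra.
move=> e e0; exists (e / k); first by rewrite divr_gt0.
move=> x; rewrite ltr_pdivlMr // => xk; apply: le_lt_trans xk.
rewrite -lecR sqnormZC rmorphM /= mulrC ler_wpM2l // ler0c; exact: sqnorm_ge0.
Qed.

Lemma bounded_lin c S T : bounded_operator S -> bounded_operator T ->
  bounded_operator (fun x => c *: S x + T x).
Proof.
move=> /bounded_operatorP[lS cS] /bounded_operatorP[lT cT].
apply/bounded_operatorP; split=> [a x y|e e0].
  rewrite (linear_opD lT) (linear_opZ lT) (linear_opD lS) (linear_opZ lS).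
  by rewrite !scalerDr !scalerA [c * a]mulrC addrACA.
have e4 : 0 < e / 4 by lra.
have [d0 d00 d0P] := @continuous_at0_scale c _ e4.
have [d1 d10 d1P] := cS _ d00; have [d2 d20 d2P] := cT _ e4.
exists (Num.min d1 d2); first by rewrite lt_min d10.
move=> x; rewrite lt_min => /andP[/d1P/d0P xS /d2P xT].
by have := sqnormD_le (c *: S x) (T x); lra.
Qed.

Lemma commutant_bounded (A : set (H -> H)) T : commutant A T -> bounded_operator T.
Proof. by case. Qed.

Lemma commutant_comm (A : set (H -> H)) T S x :
  commutant A T -> A S -> T (S x) = S (T x).
Proof. by case=> _ TA AS; rewrite -[LHS]/((T \o S) x) TA. Qed.

Lemma commutant_comp (A : set (H -> H)) S T : commutant A S -> commutant A T ->
  commutant A (S \o T).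
Proof.
move=> AS AT; split; first by apply: bounded_comp; apply: commutant_bounded; eassumption.
move=> V AV; apply/funext => x /=.
by rewrite (commutant_comm _ AT AV) (commutant_comm _ AS AV).
Qed.

Lemma commutant_lin (A : set (H -> H)) c S T : (forall V, A V -> linear V) ->
  commutant A S -> commutant A T -> commutant A (fun x => c *: S x + T x).
Proof.
move=> Al AS AT; split; first by apply: bounded_lin; apply: commutant_bounded; eassumption.
move=> V AV; apply/funext => x /=.
rewrite (linear_opD (Al V AV)) (linear_opZ (Al V AV)).
by rewrite (commutant_comm _ AT AV) (commutant_comm _ AS AV).
Qed.

Lemma commutant0 (A : set (H -> H)) : (forall V, A V -> linear V) ->
  commutant A (fun=> 0).
Proof.
move=> Al; split; last first.
  by move=> V AV; apply/funext => x /=; rewrite (linear_op0 (Al V AV)).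
apply/bounded_operatorP; split=> [a x y|]; first by rewrite scaler0 addr0.
by apply: continuous_at0_le => x; rewrite /sqnorm rdot0l; exact: sqnorm_ge0.
Qed.

Lemma commutant_sum (A : set (H -> H)) n (c : 'I_n -> R[i]) (T : 'I_n -> H -> H) :
  (forall V, A V -> linear V) -> (forall i, commutant A (T i)) ->
  commutant A (fun x => \sum_i c i *: T i x).
Proof.
move=> Al; elim: n c T => [|n IH] c T CT.
  have := commutant0 Al; congr commutant; apply/funext => x; by rewrite big_ord0.
have := commutant_lin (c ord0) Al (CT ord0)
  (IH (c \o lift ord0) _ (fun i => CT (lift ord0 i))).
by congr commutant; apply/funext => x; rewrite big_ord_recl.
Qed.

Lemma sub_bicommutant (A : set (H -> H)) T :
  bounded_operator T -> A T -> commutant (commutant A) T.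
Proof. by move=> bT AT; split=> // S [_ SA]; rewrite SA. Qed.

End BoundedOperators.

(** * Minimal projections of finite-dimensional *-algebras *)

Section MinimalProjection.
Context {R : realType} {H : hilbertType R}.
Implicit Types (x y z u v w : H) (S T p q : H -> H) (c : R[i]).

Lemma dot_sumr (I : finType) (F : I -> H) z :
  '[\sum_i F i, z] = \sum_i '[F i, z].
Proof. by elim/big_ind2: _ => [|? ? ? ? <- <-|//]; rewrite ?dot0l ?dotDl. Qed.

Definition self_adjoint T := forall x y, '[T x, y] = '[x, T y].

(** A *-algebra of operators, not required to contain the identity. *)
Record star_algebra (B : set (H -> H)) := StarAlgebra {
  star_linear : forall T, B T -> linear T;
  star_lin : forall c S T, B S -> B T -> B (fun x => c *: S x + T x);
  star_comp : forall S T, B S -> B T -> B (S \o T);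
  star_adjoint : forall T, B T ->
    exists2 T', B T' & forall x y, '[T x, y] = '[x, T' y] }.

Definition dependent n (t : 'I_n -> H -> H) :=
  exists c : 'I_n -> R[i], (exists i, c i != 0) /\
    forall x, \sum_i c i *: t i x = 0.

(** The corner p B p. *)
Definition corner (B : set (H -> H)) p : set (H -> H) :=
  [set T | [/\ B T, p \o T = T & T \o p = T]].

(** The corner p B p is one-dimensional. *)
Definition minimal_in (B : set (H -> H)) p :=
  forall T, B T -> exists c, forall x, p (T (p x)) = c *: p x.

Section Eigenprojection.
Variables (B : set (H -> H)) (p a : H -> H).
Hypotheses (Bs : star_algebra B) (Bp : B p) (pp : p \o p = p)
  (p_sa : self_adjoint p) (aB : corner B p a) (a_sa : self_adjoint a).

Let Ba : B a.
Proof. by case: aB. Qed.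

Let a_lin := star_linear Bs Ba.

Let ppE x : p (p x) = p x.
Proof. by rewrite -[LHS]/((p \o p) x) pp. Qed.

Let paE x : p (a x) = a x.
Proof. by case: aB => _ pa _; rewrite -[LHS]/((p \o a) x) pa. Qed.

Let apE x : a (p x) = a x.
Proof. by case: aB => _ _ ap; rewrite -[LHS]/((a \o p) x) ap. Qed.

(** The element (a - z_1) ... (a - z_n) p of the corner. *)
Fixpoint factors (s : seq R[i]) x : H :=
  if s is z :: s then a (factors s x) - z *: factors s x else p x.

Lemma star_sub c S T : B S -> B T -> B (fun x => S x - c *: T x).
Proof.
move=> BS BT; have := star_lin Bs (- c) BT BS; congr B.
by apply/funext => x; rewrite addrC scaleNr.
Qed.

Lemma factors_corner s : corner B p (factors s).
Proof.
elim: s => [|z s [Bs' ps sp]] /=; first by split.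
have psE x : p (factors s x) = factors s x by rewrite -[LHS]/((p \o _) x) ps.
have spE x : factors s (p x) = factors s x by rewrite -[LHS]/((_ \o p) x) sp.
split.
- by apply: (star_sub z _ Bs'); apply: (star_comp Bs Ba Bs').
- apply/funext => x /=; have lp := star_linear Bs Bp.
  by rewrite (linear_opB lp) (linear_opZ lp) paE psE.
- by apply/funext => x /=; rewrite spE.
Qed.

Lemma factors_comm s x : a (factors s x) = factors s (a x).
Proof.
elim: s x => [|z s IH] x /=; first by rewrite paE apE.
by rewrite (linear_opB a_lin) (linear_opZ a_lin) !IH.
Qed.

Lemma factors_lin s : linear (factors s).
Proof. by apply: (star_linear Bs); case: (factors_corner s). Qed.

Lemma factors_adjoint s x y :
  '[factors s x, y] = '[x, factors (map Num.conj s) y].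
Proof.
elim: s x y => [|z s IH] x y /=; first exact: p_sa.
rewrite dotBl a_sa dotZl !IH -factors_comm.
by rewrite [RHS]dotDr dotNr dotZr conjCK.
Qed.

Lemma factors_eigen s (z : R[i]) x : p x = x -> a x = z *: x ->
  factors s x = (\prod_(r <- s) (z - r)) *: x.
Proof.
move=> px ax; elim: s => [|w s IH]; first by rewrite big_nil scale1r.
rewrite big_cons /= IH (linear_opZ a_lin) ax !scalerA -scalerBl; congr (_ *: _).
by rewrite mulrBl mulrC.
Qed.

(** Here y = factors s takes its values in the eigenspace of a for z.  So does
the self-adjoint element t = y y^*, which is itself a polynomial in a and hence
acts on that eigenspace as a scalar mu.  Thus t t = mu t, and t / mu is a
projection. *)
Lemma eigenprojection s (z : R[i]) : ~ (forall x, factors s x = 0) ->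
  (forall x, a (factors s x) = z *: factors s x) ->
  exists q, [/\ corner B p q, q \o q = q, self_adjoint q,
    ~ (forall x, q x = 0) & forall x, a (q x) = z *: q x].
Proof.
move=> y0 ay; pose s' := map Num.conj s.
pose t := factors s \o factors s'.
have [By py yp] := factors_corner s; have [By' py' yp'] := factors_corner s'.
have Bt : B t by exact: (star_comp Bs).
have pt : p \o t = t by rewrite compA py.
have tp : t \o p = t by rewrite -compA yp'.
have t_sa : self_adjoint t.
  have s'K : map Num.conj s' = s by rewrite /s' mapK //; exact: conjCK.
  by move=> x v; rewrite /t /= factors_adjoint -/s' factors_adjoint s'K.
have at_ x : a (t x) = z *: t x by exact: ay.
(* Both factors of [t] act on an eigenvector of [a] as scalars. *)
have [mu tt] : exists mu, forall x, t (t x) = mu *: t x.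
  eexists=> x; have ptx : p (t x) = t x by rewrite -[LHS]/((p \o t) x) pt.
  rewrite {1}/t /= (factors_eigen s' ptx (at_ x)).
  by rewrite (linear_opZ (factors_lin s)) (factors_eigen s ptx (at_ x)) scalerA.
have t_neq0 : exists x, t x != 0.
  apply: contra_notP y0 => /forallNP t0 x.
  have {}t0 v : t v = 0 by apply/eqP/negPn/negP; exact: t0.
  apply: dot_eq0; rewrite factors_adjoint -/s'.
  suff -> : factors s' (factors s x) = 0 by rewrite dotC dot0l rmorph0.
  have y'0 v : factors s' v = 0.
    apply: dot_eq0; rewrite dotC -factors_adjoint -[factors s _]/(t v) t0.
    by rewrite dot0l rmorph0.
  exact: y'0.
have [x tx] := t_neq0.
have ttx : '[t x, t x] = mu * '[t x, x] by rewrite -t_sa tt dotZl.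
have mu0 : mu != 0.
  apply: contra_neq tx => mu0; apply: dot_eq0; rewrite ttx mu0 mul0r //.
have mu_real : mu^* = mu.
  have tx0 : '[t x, x] != 0.
    apply: contra_neq tx => tx0; apply: dot_eq0; rewrite ttx tx0 mulr0 //.
  have c1 : '[t x, x]^* = '[t x, x] by rewrite -dotC -t_sa.
  have c2 : '[t x, t x]^* = '[t x, t x] by rewrite -dotC.
  by apply: (mulIf tx0); rewrite -ttx -c2 ttx rmorphM /= c1.
exists (fun v => mu^-1 *: t v); split.
- split.
  + have := star_lin Bs (mu^-1 - 1) Bt Bt; congr B; apply/funext => v.
    by rewrite scalerBl scale1r subrK.
  + apply/funext => v /=; rewrite (linear_opZ (star_linear Bs Bp)).
    by rewrite -[p (t v)]/((p \o t) v) pt.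
  + by apply/funext => v /=; rewrite -[t (p v)]/((t \o p) v) tp.
- apply/funext => v /=.
  by rewrite (linear_opZ (star_linear Bs Bt)) tt !scalerA -mulrA mulVf // mulr1.
- by move=> u v; rewrite dotZl dotZr t_sa fmorphV /= mu_real.
- by move=> /(_ x)/eqP; rewrite scaler_eq0 invr_eq0 (negPf mu0) (negPf tx).
- by move=> v; rewrite (linear_opZ a_lin) at_ !scalerA mulrC.
Qed.

End Eigenprojection.

Section Polynomial.
Variables (a p : H -> H).
Hypothesis a_lin : linear a.

(** The operator f(a) p for f of size at most n.  The bound is kept apart from
the size of f so that multiplying f by a factor X - z just increments it. *)
Definition poly_op n (f : {poly R[i]}) x := \sum_(i < n) f`_i *: iter i a (p x).

Lemma linear_op_sum (T : H -> H) n (F : 'I_n -> H) : linear T ->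
  T (\sum_i F i) = \sum_i T (F i).
Proof.
move=> lT; elim: n F => [|n IH] F; first by rewrite !big_ord0 linear_op0.
by rewrite !big_ord_recl (linear_opD lT) IH.
Qed.

Lemma poly_op_widen m n (f : {poly R[i]}) x : (size f <= m)%N -> (m <= n)%N ->
  poly_op n f x = poly_op m f x.
Proof.
move=> fm mn; rewrite /poly_op (big_ord_widen n (fun i => f`_i *: iter i a (p x)) mn).
rewrite [LHS](bigID (fun i : 'I_n => (i < m)%N)) /= [X in _ + X]big1 ?addr0 //.
move=> i; rewrite -leqNgt => mi.
by rewrite nth_default ?scale0r // (leq_trans fm).
Qed.

Lemma poly_opZ n (c : R[i]) (f : {poly R[i]}) x :
  poly_op n (c *: f) x = c *: poly_op n f x.
Proof.
by rewrite /poly_op scaler_sumr; apply: eq_bigr => i _; rewrite coefZ scalerA.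
Qed.

Lemma poly_op_mulXsubC n (f : {poly R[i]}) (z : R[i]) x : (size f <= n)%N ->
  poly_op n.+1 (('X - z%:P) * f) x = a (poly_op n f x) - z *: poly_op n f x.
Proof.
move=> fn; rewrite /poly_op.
under eq_bigr do rewrite mulrBl coefB coefCM coefXM scalerBl.
rewrite sumrB; congr (_ - _).
  rewrite big_ord_recl /= scale0r add0r (linear_op_sum _ a_lin).
  by apply: eq_bigr => i _; rewrite (linear_opZ a_lin).
rewrite big_ord_recr /= (nth_default _ fn) mulr0 scale0r addr0 scaler_sumr.
by apply: eq_bigr => i _; rewrite scalerA.
Qed.

Lemma poly_op_factors s x :
  poly_op (size s).+1 (\prod_(z <- s) ('X - z%:P)) x = factors p a s x.
Proof.
elim: s => [|z s IH] /=.
  by rewrite /poly_op big_ord1 big_nil /= coef1 scale1r.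
by rewrite big_cons poly_op_mulXsubC ?IH // size_prod_XsubC.
Qed.

End Polynomial.

Section Existence.
Variable B : set (H -> H).
Hypothesis Bs : star_algebra B.

(** An element p T p which is not a multiple of p has a real or an imaginary part
which is not a multiple of p either. *)
Lemma nonscalar_self_adjoint p : B p -> p \o p = p -> self_adjoint p ->
  ~ minimal_in B p ->
  exists a, [/\ corner B p a, self_adjoint a &
    forall c, ~ (forall x, a x = c *: p x)].
Proof.
move=> Bp pp p_sa; apply: contra_notP => no_a T BT.
have scalar a : corner B p a -> self_adjoint a ->
    exists c, forall x, a x = c *: p x.
  move=> aB a_sa; apply: contrapT => /forallNP ac; apply: no_a.
  by exists a; split.
have [T' BT' TT'] := star_adjoint Bs BT.
have T'T x y : '[T' x, y] = '[x, T y] by rewrite dotC -TT' -dotC.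
pose b := p \o T \o p; pose b' := p \o T' \o p.
have Bb : B b by do 2! apply: (star_comp Bs) => //.
have Bb' : B b' by do 2! apply: (star_comp Bs) => //.
have bb' x y : '[b x, y] = '[x, b' y] by rewrite /b /b' /= !p_sa TT' p_sa.
have b'b x y : '[b' x, y] = '[x, b y] by rewrite dotC -bb' -dotC.
have lp := star_linear Bs Bp.
have ppE x : p (p x) = p x by rewrite -[LHS]/((p \o p) x) pp.
have comb c c' : corner B p (fun x => c *: b x + c' *: b' x).
  have B0 : B (fun x => c' *: b' x).
    have := star_lin Bs (c' - 1) Bb' Bb'; congr B; apply/funext => x.
    by rewrite scalerBl scale1r subrK.
  split; first exact: star_lin.
  - apply/funext => x /=; rewrite (linear_opD lp) !(linear_opZ lp).
    by rewrite /b /b' /= !ppE.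
  - by apply/funext => x /=; rewrite /b /b' /= !ppE.
have [|c1 c1P] := scalar _ (comb 1 1).
  by move=> x y; rewrite !scale1r dotDl dotDr bb' b'b addrC.
have [|c2 c2P] := scalar _ (comb 'i (- 'i)).
  move=> x y; rewrite !scaleNr dotBl dotDr dotNr !dotZl !dotZr bb' b'b.
  by rewrite conjCi !mulNr opprK addrC.
exists (2^-1 * (c1 - 'i * c2)) => x.
have ii (u : H) : 'i *: ('i *: u) = - u by rewrite scalerA -expr2 sqrCi scaleN1r.
rewrite -scalerA scalerBl -c1P -scalerA -c2P !scale1r scaleNr.
rewrite ['i *: (_ - _)]scalerBr !ii opprK opprD opprK addrACA subrr addr0.
by rewrite scalerDr -scalerDl -[2^-1]mul1r -splitr scale1r.
Qed.

(** The powers of a non-scalar self-adjoint a of p B p are linearly dependent, so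
a is annihilated by a polynomial, which splits over the complex numbers.
Removing its linear factors one at a time until the product no longer vanishes
leaves a nonzero y with a y = z y, hence an eigenprojection of a for z.  It
differs from p because a is not a multiple of p. *)
Lemma smaller_projection p n : B p -> p \o p = p -> self_adjoint p ->
  ~ minimal_in B p ->
  (forall t : 'I_n -> H -> H, (forall i, corner B p (t i)) -> dependent t) ->
  exists q, [/\ corner B p q, q \o q = q, self_adjoint q,
    ~ (forall x, q x = 0) & q <> p].
Proof.
move=> Bp pp p_sa p_min depP.
have [a [aB a_sa a_ns]] := nonscalar_self_adjoint Bp pp p_sa p_min.
have [Ba pa ap] := aB; have a_lin := star_linear Bs Ba.
pose t (i : 'I_n) := iter i (comp a) p.
have tE i x : t i x = iter i a (p x).
  by rewrite /t; elim: (val i) => //= k ->.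
have [|c [[i0 ci0] c0]] := depP t.
  move=> i; rewrite /t; elim: (val i) => [|k [Bk pk kp]] //=.
  split; first exact: star_comp.
  - by rewrite compA pa.
  - by rewrite -compA kp.
pose f := \poly_(i < n) (if insub i is Some j then c j else 0).
have fE (i : 'I_n) : f`_i = c i by rewrite coef_poly ltn_ord valK.
have f0 x : poly_op a p n f x = 0.
  by rewrite -(c0 x); apply: eq_bigr => i _; rewrite fE tE.
have fN0 : f != 0 by apply: contra_neq ci0 => f0'; rewrite -fE f0' coef0.
have [s fs] := closed_field_poly_normal f.
have sn : (size s < n)%N.
  have := size_poly n (fun i => if insub i is Some j then c j else 0).
  rewrite -/f fs size_scale ?lead_coef_eq0 // size_prod_XsubC //.
have s0 x : factors p a s x = 0.
  have := f0 x; rewrite (@poly_op_widen _ _ (size s).+1) //; last first.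
    by rewrite fs size_scale ?lead_coef_eq0 // size_prod_XsubC.
  rewrite fs poly_opZ poly_op_factors // => /eqP.
  by rewrite scaler_eq0 lead_coef_eq0 (negPf fN0) => /eqP.
have [s' [z [y0 ay]]] : exists s' (z : R[i]), ~ (forall x, factors p a s' x = 0) /\
    forall x, a (factors p a s' x) = z *: factors p a s' x.
  elim: s s0 {fs sn} => [|z s IH] s0.
    case: (a_ns 0) => x; rewrite scale0r -[a x]/(a x) -ap /=.
    by rewrite [p x]s0 linear_op0.
  have [/IH//|y0] := pselect (forall x, factors p a s x = 0).
  exists s, z; split=> // x; apply/eqP; rewrite -subr_eq0; apply/eqP.
  exact: s0.
have [q [qB qq q_sa q0 aq]] := eigenprojection Bs Bp pp p_sa aB a_sa y0 ay.
exists q; split=> // qp; apply: (a_ns z) => x; rewrite -qp -aq qp.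
by rewrite -[in LHS]ap.
Qed.

(** The dimension of p B p drops strictly in q B q when q < p: since p is not in
q B q, independent elements of q B q stay independent together with p. *)
Lemma minimal_projection_below p n : B p -> p \o p = p -> self_adjoint p ->
  ~ (forall x, p x = 0) ->
  (forall t : 'I_n -> H -> H, (forall i, corner B p (t i)) -> dependent t) ->
  exists q, [/\ B q, q \o q = q, self_adjoint q, ~ (forall x, q x = 0) &
    minimal_in B q].
Proof.
elim: n p => [|n IH] p Bp pp p_sa p0 depP.
  by have [[]|c [[[]]]] := depP (fun=> p).
have [pmin|pmin] := pselect (minimal_in B p); first by exists p; split.
have [q [[Bq pq qp] qq q_sa q0 q_neq_p]] := smaller_projection Bp pp p_sa pmin depP.
apply: (IH q) => // t tB.
have Tq T x : corner B q T -> q (T x) = T x.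
  by case=> _ qT _; rewrite -[LHS]/((q \o T) x) qT.
pose t' (i : 'I_n.+1) := if unlift ord_max i is Some j then t j else p.
have [|c [[i ci] c0]] := depP t'.
  move=> i; rewrite /t'; case: unliftP => [j _|_]; last by split.
  have [Bt qt tq] := tB j; split=> //.
  - by rewrite -qt compA pq.
  - by rewrite -tq -compA qp.
have lp := star_linear Bs Bp; have lq := star_linear Bs Bq.
have cE x : c ord_max *: p x = - \sum_(j < n) c (lift ord_max j) *: t j x.
  apply/eqP; rewrite -addr_eq0 addrC; apply/eqP.
  apply: etrans (c0 x); rewrite [RHS]big_ord_recr /=; congr (_ + _).
    apply: eq_bigr => j _; rewrite /t'.
    have -> : widen_ord (leqnSn n) j = lift ord_max j.
      by apply: val_inj; rewrite /= /bump leqNgt ltn_ord.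
    by rewrite liftK.
  by rewrite /t' unlift_none.
(* Otherwise [p] would be a combination of elements of q B q, whence [q p = p]. *)
have cmax : c ord_max = 0.
  apply/eqP/negPn/negP => cm0; apply: q_neq_p; apply/funext => x.
  apply: (scalerI cm0); rewrite -[in RHS]/(c ord_max *: p x).
  have qpx : q (p x) = q x by rewrite -[LHS]/((q \o p) x) qp.
  rewrite -qpx -(linear_opZ lq) cE (linear_opN lq) (linear_op_sum _ lq).
  by congr (- _); apply: eq_bigr => j _; rewrite (linear_opZ lq) Tq.
exists (fun j => c (lift ord_max j)); split; last first.
  by move=> x; apply/eqP; rewrite -oppr_eq0 -cE cmax scale0r.
case: (unliftP ord_max i) ci => [j ->|->]; first by exists j.
by rewrite cmax eqxx.
Qed.

End Existence.

Lemma span_dependent n (k : 'I_n -> H -> H) (t : 'I_n.+1 -> H -> H) :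
  (forall i, exists c : 'I_n -> R[i], forall x, t i x = \sum_j c j *: k j x) ->
  dependent t.
Proof.
move=> /choice[c cP]; pose A := \matrix_(i < n.+1, j < n) c i j.
have : kermx A != 0.
  rewrite kermx_eq0 /row_free; apply: contraTneq (rank_leq_col A) => ->.
  by rewrite ltnn.
case/rowV0Pn=> v /sub_kermxP vA v0.
exists (fun i => v 0 i); split.
  apply: contrapT => /forallNP v0'; case/eqP: v0; apply/rowP => i.
  by rewrite mxE; apply/eqP/negPn/negP; exact: v0'.
move=> x; under eq_bigr do rewrite cP scaler_sumr.
rewrite exchange_big /= big1 // => j _.
have := congr1 (fun B : 'rV_n => B 0 j) vA; rewrite !mxE => vAj.
rewrite (eq_bigr (fun i => (v 0 i * A i j) *: k j x)); last first.
  by move=> i _; rewrite scalerA mxE.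
by rewrite -scaler_suml vAj scale0r.
Qed.

End MinimalProjection.

(** * Extension of isometries and free amalgams in the Urysohn space *)

Section Urysohn.
Context {R : realType} (Delta : set R) (U : metricType R).
Hypotheses (Dset : distance_set Delta) (Uurysohn : urysohn_space Delta U).
Implicit Types (x y z a b c : U) (K s : R) (A B C F X : seq U).
Local Notation G := (Isom U).
Local Notation d := (@mdist R U).

Lemma Delta0 : Delta 0.
Proof.
case: Dset => [[] //|[S [r [[_ S0 Sge SD] Sr ->]]]]; split => //=.
by rewrite in_itv /= lexx Sge.
Qed.

Lemma Delta_ge0 s : Delta s -> 0 <= s.
Proof. by case: Dset => [[_ _ + _]|[S [r [[_ _ Sge _] _ ->]]]]; [exact|case=> /Sge]. Qed.

(** Truncating sums at an element of Delta puts semigroups and their bounded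
initial segments on the same footing. *)
Lemma Delta_cap s t K : Delta s -> Delta t -> Delta K -> Delta (Num.min K (s + t)).
Proof.
case: Dset => [[_ _ Sge SD] Ds Dt DK|[S [r [[_ _ Sge SD] _ ->]]]].
  by have [_|_] := leP K (s + t) => //; exact: SD.
move=> [Ss _] [St _] [SK]; rewrite /= in_itv /= => /andP[K0 Kr].
have := SD _ _ Ss St; split; first by have [_|_] := leP K (s + t).
by rewrite /= in_itv /= le_min K0 Sge //= ge_min Kr.
Qed.

Lemma Delta_dist x y : Delta (d x y).
Proof. by case: Uurysohn => _ + _ _; exact. Qed.

(** Adjoin to F an abstract point at distances phi.  By universality the result
embeds in U, and by homogeneity the copy of F can be brought back onto F.  When
phi vanishes at some x, the new point would coincide with x, which then is a
solution. *)
Lemma one_point_extension F (phi : U -> R) :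
  {in F, forall x, Delta (phi x)} ->
  {in F &, forall x y, phi x <= d x y + phi y} ->
  {in F &, forall x y, d x y <= phi x + phi y} ->
  exists u, {in F, forall x, d u x = phi x}.
Proof.
move=> phiD phiL phiT.
have [[x xF phix0]|phi0] := pselect (exists2 x, x \in F & phi x = 0).
  exists x => y yF; apply/eqP; rewrite eq_le.
  have := phiT x y xF yF; have := phiL y x yF xF.
  by rewrite phix0 addr0 add0r metric_sym => -> ->.
pose T := option (seq_sub F).
pose dist (p q : T) : R := match p, q with
  | None, None => 0
  | Some x, None => phi (val x)
  | None, Some y => phi (val y)
  | Some x, Some y => d (val x) (val y)
  end.
have dist0 p : dist p p = 0 by case: p => //= x; rewrite mdistxx.
have dist_pos p q : dist p q = 0 -> p = q.
  case: p q => [x|] [y|] //=.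
  - by move=> /mdist_positivity/val_inj ->.
  - by move=> x0; case: phi0; exists (val x) => //; exact: valP.
  - by move=> x0; case: phi0; exists (val y) => //; exact: valP.
have dist_sym p q : dist p q = dist q p.
  by case: p q => [x|] [y|] //=; rewrite metric_sym.
have dist_tri q p r : dist p r <= dist p q + dist q r.
  have vF (x : seq_sub F) : val x \in F by exact: valP.
  have pos (x : seq_sub F) : 0 <= phi (val x) by apply: Delta_ge0; exact: phiD.
  case: p q r => [x|] [y|] [z|] //=; rewrite ?addr0 ?add0r ?addr_ge0 //; try exact: pos.
  - exact: metric_triangle.
  - by apply: phiL; exact: vF.
  - by apply: phiT; exact: vF.
  - by rewrite addrC metric_sym; apply: phiL; exact: vF.
pose mV := isMetric.Build R T dist0 dist_pos dist_sym dist_tri.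
pose V : metricType R := HB.pack T mV.
have [Vc VD] : countable [set: V] /\ metric_space_in Delta V.
  split; first exact: (@countableP T).
  move=> [x|] [y|].
  - exact: Delta_dist.
  - by apply: phiD; exact: valP.
  - by apply: phiD; exact: valP.
  - exact: Delta0.
have [_ _ Uhom Uuniv] := Uurysohn.
have [j jP] := Uuniv V Vc VD.
pose jF (x : seq_sub F) : U := j (Some x : T).
have jFP p q : d (jF p) (jF q) = d (val p) (val q) by rewrite jP.
pose f z := if pselect (exists p, jF p = z) is left e
  then val (sval (cid e)) else z.
have fj p : f (jF p) = val p.
  rewrite /f; case: pselect => [e|[]]; last by exists p.
  case: cid => q /= jqp; apply: (@mdist_positivity R).
  by rewrite -jFP jqp mdistxx.
have fA : finite_set (range jF) by apply: finite_image; exact: finite_finset.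
have [|g gP] := Uhom _ f fA.
  by move=> _ _ /set_mem[x _ <-] /set_mem[y _ <-]; rewrite !fj jFP.
exists (isom_fun g (j None)) => x xF.
have gx : isom_fun g (jF (SeqSub xF)) = x.
  by rewrite gP ?fj //; apply: mem_set; exists (SeqSub xF).
by rewrite -[x in LHS]gx isom_funP jP.
Qed.

(** The same extension for a family of points, possibly with repetitions: the
bound phi t <= d (x t) (x u) + phi u makes phi a function of the point. *)
Lemma one_point_extension_family (T : eqType) (J : seq T) (x : T -> U)
    (phi : T -> R) :
  {in J, forall t, Delta (phi t)} ->
  {in J &, forall t u, phi t <= d (x t) (x u) + phi u} ->
  {in J &, forall t u, d (x t) (x u) <= phi t + phi u} ->
  exists u, {in J, forall t, d u (x t) = phi t}.
Proof.
move=> phiD phiL phiT.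
have phi_wd : {in J &, forall t u, x t = x u -> phi t = phi u}.
  move=> t u tJ uJ xtu; apply/eqP; rewrite eq_le.
  have := phiL t u tJ uJ; have := phiL u t uJ tJ.
  by rewrite xtu mdistxx !add0r => -> ->.
pose psi y := if pselect (exists2 t, t \in J & x t = y) is left e
  then phi (sval (cid2 e)) else 0.
have psiE : {in J, forall t, psi (x t) = phi t}.
  move=> t tJ; rewrite /psi; case: pselect => [e|[]]; last by exists t.
  by case: cid2 => u uJ xut; exact: phi_wd.
have [||| u uP] := @one_point_extension (map x J) psi.
- by move=> _ /mapP[t tJ ->]; rewrite psiE //; exact: phiD.
- by move=> _ _ /mapP[t tJ ->] /mapP[u uJ ->]; rewrite !psiE //; exact: phiL.
- by move=> _ _ /mapP[t tJ ->] /mapP[u uJ ->]; rewrite !psiE //; exact: phiT.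
by exists u => t tJ; rewrite uP ?psiE // map_f.
Qed.

Lemma homogeneity A (f : U -> U) :
  {in A &, forall a b, d (f a) (f b) = d a b} ->
  exists g : G, {in A, isom_fun g =1 f}.
Proof.
move=> fA; have [_ _ Uhom _] := Uurysohn.
have [|g gP] := Uhom [set` A] f (finite_seq A).
  by move=> a b /set_mem/= aA /set_mem/= bA; exact: fA.
by exists g => a aA; apply: gP; exact: mem_set.
Qed.

(** The hypotheses are the triangle inequalities between an isometric copy of A
and the points x t when the prescribed distances are f; the points of the copy
are added one by one. *)
Lemma copy_extension (T : eqType) (J : seq T) (x : T -> U) A (f : U -> T -> R) :
  {in A & J, forall a t, Delta (f a t)} ->
  {in A, forall a, {in J &, forall t u, f a t <= d (x t) (x u) + f a u}} ->
  {in A, forall a, {in J &, forall t u, d (x t) (x u) <= f a t + f a u}} ->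
  {in A &, forall a b, {in J, forall t, f a t <= d a b + f b t}} ->
  {in A &, forall a b, {in J, forall t, d a b <= f a t + f b t}} ->
  exists g : G, {in A & J, forall a t, d (isom_fun g a) (x t) = f a t}.
Proof.
move=> fD fL fT fLA fTA.
suff [u uA uJ] : exists2 u : U -> U,
    {in A &, forall a b, d (u a) (u b) = d a b} &
    {in A & J, forall a t, d (u a) (x t) = f a t}.
  have [g gP] := homogeneity uA.
  by exists g => a t aA tJ; rewrite gP // uJ.
elim: A => [|a A IH] in fD fL fT fLA fTA *; first by exists id.
have sA : {subset A <= a :: A} by move=> b; rewrite inE orbC => ->.
have aA : a \in a :: A by rewrite mem_head.
have [|||||u uA uJ] := IH.
- by move=> b t /sA; exact: fD.
- by move=> b /sA; exact: fL.
- by move=> b /sA; exact: fT.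
- by move=> b c /sA bA /sA; exact: fLA.
- by move=> b c /sA bA /sA; exact: fTA.
pose x' (t : T + U) := match t with inl t => x t | inr b => u b end.
pose phi (t : T + U) := match t with inl t => f a t | inr b => d a b end.
pose J' := map inl J ++ map inr A : seq (T + U).
have J'P t : t \in J' -> match t with inl t => t \in J | inr b => b \in A end.
  by rewrite mem_cat => /orP[] /mapP[? ? ->].
have [|||v vP] := @one_point_extension_family _ J' x' phi.
- by move=> [t|b] /J'P => [tJ|_]; [exact: fD | exact: Delta_dist].
- move=> [t|b] [w|c] /J'P tJ /J'P wJ /=.
  + exact: fL.
  + by rewrite metric_sym uJ // addrC; apply: fLA => //; exact: sA.
  + by rewrite uJ // addrC; apply: fTA => //; exact: sA.
  + by rewrite uA // addrC [d b c]metric_sym metric_triangle.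
- move=> [t|b] [w|c] /J'P tJ /J'P wJ /=.
  + exact: fT.
  + by rewrite metric_sym uJ // addrC [d a c]metric_sym; apply: fLA => //; exact: sA.
  + by rewrite uJ // metric_sym; apply: fLA => //; exact: sA.
  + by rewrite uA // [d a b]metric_sym metric_triangle.
have vA : {in A, forall b, d v (u b) = d a b}.
  by move=> b bA; rewrite (vP (inr b)) // mem_cat map_f ?orbT.
have vJ : {in J, forall t, d v (x t) = f a t}.
  by move=> t tJ; rewrite (vP (inl t)) // mem_cat map_f.
pose u' b := if b \in A then u b else v.
have u'P b : b \in a :: A -> b \in A /\ u' b = u b \/ b = a /\ u' b = v.
  by rewrite inE /u'; case: ifP => bA; [left|rewrite orbF => /eqP; right].
exists u' => [b c /u'P[[bA ->]|[-> ->]] /u'P[[cA ->]|[-> ->]]|b t].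
- exact: uA.
- by rewrite metric_sym vA // metric_sym.
- exact: vA.
- by rewrite !mdistxx.
- by move=> /u'P[[bA ->]|[-> ->]] tJ; [exact: uJ | exact: vJ].
Qed.

(** The pair (g A, h B) is isometric to (g' A, h' B).  The prescription on
g' A and the one on h' B agree where these meet, as points at distance 0 are
sent to points at distance 0. *)
Lemma joint_extension A B (g h g' h' : G) :
  {in A & B, forall a b, d (isom_fun g a) (isom_fun h b) =
                         d (isom_fun g' a) (isom_fun h' b)} ->
  exists k : G, {in A, forall a, isom_fun k (isom_fun g' a) = isom_fun g a} /\
                {in B, forall b, isom_fun k (isom_fun h' b) = isom_fun h b}.
Proof.
move=> ghP.
pose A' := map (isom_fun g') A; pose B' := map (isom_fun h') B.
pose f x := if x \in A' then isom_fun g (isom_fun g'^-1%g x)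
            else isom_fun h (isom_fun h'^-1%g x).
have invK (k : G) x : isom_fun k^-1%g (isom_fun k x) = x.
  by apply: (@isom_fun_inj _ _ k); rewrite isom_inv_funK.
have fA a : a \in A -> f (isom_fun g' a) = isom_fun g a.
  by move=> aA; rewrite /f map_f // invK.
have fB b : b \in B -> f (isom_fun h' b) = isom_fun h b.
  move=> bB; rewrite /f; case: ifP => [|_]; last by rewrite invK.
  move=> /mapP[a aA e]; rewrite e invK; apply: (@mdist_positivity R).
  by rewrite ghP // -e mdistxx.
have [|k kP] := @homogeneity (A' ++ B') f.
  move=> x y; rewrite !mem_cat.
  move=> /orP[]/mapP[a aA ->] /orP[]/mapP[b bA ->]; rewrite ?fA ?fB //.
  - by rewrite !isom_funP.
  - by rewrite ghP.
  - by rewrite metric_sym ghP // metric_sym.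
  - by rewrite !isom_funP.
exists k; split=> [a aA|b bB].
  by rewrite kP ?fA // mem_cat map_f.
by rewrite kP ?fB // mem_cat map_f ?orbT.
Qed.

(** What makes rho a b a possible distance between the point a of one copy of A
and the point b of another copy; the value 0 is allowed, so that two copies may
share points. *)
Record admissible A (rho : U -> U -> R) := Admissible {
  adm_Delta : {in A &, forall a b, Delta (rho a b)};
  adm_sym : {in A &, forall a b, rho a b = rho b a};
  adm_ge : {in A &, forall a b, d a b <= rho a b};
  adm_lip : forall a b c, a \in A -> b \in A -> c \in A ->
    rho a c <= d a b + rho b c }.

Lemma adm_triangle A rho a b c : admissible A rho ->
  a \in A -> b \in A -> c \in A -> d a b <= rho a c + rho b c.
Proof.
move=> rhoP aA bA cA; apply: le_trans (metric_triangle a c b) _.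
rewrite lerD ?(adm_ge rhoP) //.
by rewrite metric_sym (adm_ge rhoP).
Qed.

Definition mutual A (rho : U -> U -> R) (g h : G) :=
  {in A &, forall a b, d (isom_fun g a) (isom_fun h b) = rho a b}.

(** Copies of A which have the same distances to B as A itself, and in which the
i-th and j-th copies are at distances rho i j.  They are built one at a time: the
new copy must satisfy the triangle inequalities with B and all the previous
ones. *)
Lemma exists_copies A B (rho : nat -> nat -> U -> U -> R) n :
  (forall i j, admissible A (rho i j)) ->
  (forall i j, rho i j = rho j i) ->
  (forall i j k a b c, a \in A -> b \in A -> c \in A ->
     rho i k a c <= rho i j a b + rho j k b c) ->
  (forall i j b, b \in B -> {in A &, forall a c, rho i j a c <= d a b + d b c}) ->
  (forall i j b, b \in B -> {in A &, forall a c, d a b <= rho i j a c + d c b}) ->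
  exists g : nat -> G,
    (forall i j, (i < n)%N -> (j < n)%N -> i <> j ->
       mutual A (rho i j) (g i) (g j)) /\
    (forall i, (i < n)%N -> {in A & B, forall a b, d (isom_fun (g i) a) b = d a b}).
Proof.
move=> rhoP rhoC rho3 rhoB rhoB'.
elim: n => [|n [g [gP gB]]]; first by exists (fun=> 1%g).
pose J := map inl [seq (i, a) | i <- iota 0 n, a <- A] ++ map inr B : seq (nat * U + U).
pose x (t : nat * U + U) :=
  match t with inl ia => isom_fun (g ia.1) ia.2 | inr b => b end.
pose f a (t : nat * U + U) :=
  match t with inl ia => rho n ia.1 a ia.2 | inr b => d a b end.
have JP t : t \in J -> match t with
    inl ia => (ia.1 < n)%N /\ ia.2 \in A | inr b => b \in B end.
  rewrite mem_cat => /orP[] /mapP[y yJ ->] //.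
  by case/allpairsP: yJ => -[i a] /= [+ aA ->]; rewrite mem_iota.
have JlP i a : (i < n)%N -> a \in A -> inl (i, a) \in J.
  move=> ni aA; rewrite mem_cat map_f //.
  by apply/allpairsP; exists (i, a); rewrite mem_iota.
have JrP b : b \in B -> inr b \in J by move=> bB; rewrite mem_cat map_f ?orbT.
have [|||||h hP] := @copy_extension _ J x A f.
- move=> a [[i b]|b] aA /JP => [[_ bA]|_] /=; last exact: Delta_dist.
  exact: adm_Delta.
- move=> a aA [[i b]|b] [[j c]|c] /JP + /JP /=
    => [[ni bA] [nj cA]|[ni bA] cB|bB [nj cA]|bB cB].
  + have [->|/eqP ij] := eqVneq i j.
      rewrite isom_funP (adm_sym (rhoP n j) aA bA) (adm_sym (rhoP n j) aA cA).
      exact: (adm_lip (rhoP n j)).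
    rewrite gP // addrC -(adm_sym (rhoP i j) cA bA) (rhoC i j).
    exact: rho3.
  + by rewrite gB // addrC [d b c]metric_sym; exact: rhoB.
  + by rewrite [d b _]metric_sym gB // addrC; exact: rhoB'.
  + by rewrite addrC [d b c]metric_sym metric_triangle.
- move=> a aA [[i b]|b] [[j c]|c] /JP + /JP /=
    => [[ni bA] [nj cA]|[ni bA] cB|bB [nj cA]|bB cB].
  + have [->|/eqP ij] := eqVneq i j.
      rewrite isom_funP (adm_sym (rhoP n j) aA bA) (adm_sym (rhoP n j) aA cA).
      exact: adm_triangle.
    rewrite gP // (adm_sym (rhoP n i) aA bA) (rhoC n i).
    exact: rho3.
  + by rewrite gB // (adm_sym (rhoP n i) aA bA); exact: rhoB'.
  + rewrite [d b _]metric_sym gB // (adm_sym (rhoP n j) aA cA) addrC.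
    exact: rhoB'.
  + by rewrite [d a b]metric_sym metric_triangle.
- move=> a b aA bA [[i c]|c] /JP /= => [[ni cA]|cB]; last exact: metric_triangle.
  exact: (adm_lip (rhoP n i)).
- move=> a b aA bA [[i c]|c] /JP /= => [[ni cA]|cB].
    exact: adm_triangle.
  by rewrite [d b c]metric_sym metric_triangle.
pose g' i := if i == n then h else g i.
exists g'; rewrite /g'; split.
  move=> i j; rewrite !ltnS (leq_eqVlt i) (leq_eqVlt j) => in_ jn ij; move: in_ jn.
  have [ei|/eqP iN] := eqVneq i n; have [ej|/eqP jN] := eqVneq j n => /=.
  - by case: ij; rewrite ei ej.
  - by move=> _ jn a b aA bA; rewrite ei (hP a (inl (j, b))) //; exact: JlP.
  - move=> ni _ a b aA bA; rewrite ej metric_sym (hP b (inl (i, a))) ?JlP //=.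
    by rewrite rhoC; apply: (adm_sym (rhoP i n)).
  - by move=> *; exact: gP.
move=> i; rewrite ltnS leq_eqVlt => in_ a b aA bB; move: in_.
case: eqVneq => [_ _|_ /= ni]; last exact: gB.
by rewrite (hP a (inr b)) //; exact: JrP.
Qed.

(** The distances min K (2^n s0) all lie in Delta and reach K, as R is
archimedean.  The alternative s0 = K covers K = 0. *)
Lemma doubling (P : R -> Prop) s0 K : Delta s0 -> Delta K -> s0 <= K ->
  0 < s0 \/ s0 = K -> P s0 ->
  (forall s t, Delta s -> Delta t -> 0 < s -> s <= t -> t <= s + s -> P s -> P t) ->
  P K.
Proof.
move=> Ds0 DK s0K [s0_gt0|<-//] Ps0 step.
have [n nP] : exists n : nat, K <= n%:R * s0.
  exists (Num.truncn (K / s0)).+1; rewrite -ler_pdivrMr //.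
  exact/ltW/truncnS_gt.
have [s [Ds sK s0s Ps]] : exists s, [/\ Delta s, s <= K,
    Num.min K (n%:R * s0) <= s /\ s0 <= s & P s].
  elim: n {nP} => [|n [s [Ds sK [ns s0s] Ps]]].
    by exists s0; split=> //; rewrite mul0r ge_min (ltW s0_gt0) orbT.
  exists (Num.min K (s + s)); split.
  - exact: Delta_cap.
  - by rewrite ge_min lexx.
  - have s_gt0 : 0 < s by exact: lt_le_trans s0s.
    split; last by rewrite le_min s0K /=; lra.
    rewrite le_min ge_min lexx /= ge_min; apply/orP.
    move: ns; have [h|h] := leP K (n%:R * s0) => ns; first by left; lra.
    by right; rewrite -natr1 mulrDl mul1r; lra.
  - apply: (step s) => //; first exact: Delta_cap.
    + exact: lt_le_trans s0s.
    + by rewrite le_min sK /=; have := lt_le_trans s0_gt0 s0s; lra.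
    + by rewrite ge_min lexx orbT.
have -> : K = s; last exact: Ps.
apply/eqP; rewrite eq_le sK andbT; apply: le_trans s0s.1.
by rewrite le_min lexx.
Qed.

Lemma dist_bound X K : Delta K ->
  exists L, [/\ Delta L, K <= L & {in X &, forall x y, d x y <= L}].
Proof.
move=> DK; pose D := [seq d x y | x <- X, y <- X].
have [L [DL KL LP]] : exists L, [/\ Delta L, K <= L & {in D, forall t, t <= L}].
  have : {in D, forall t, Delta t}.
    by move=> t /allpairsP[[x y] [_ _ ->]]; exact: Delta_dist.
  elim: D => [_|t D IH DD]; first by exists K.
  have [|L [DL KL LP]] := IH.
    by move=> u uD; apply: DD; rewrite inE uD orbT.
  exists (Num.max t L); split.
  - by have [_|_] := leP t L; [|apply: DD; rewrite mem_head].
  - by rewrite le_max KL orbT.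
  - move=> u; rewrite inE => /predU1P[->|/LP uL]; rewrite le_max ?lexx //.
    by rewrite uL orbT.
exists L; split=> // x y xX yX; apply: LP.
by apply/allpairsP; exists (x, y).
Qed.

(** The distance between a and b in two copies of A glued along X and otherwise
as far apart as possible, truncated at K.  The truncation keeps it in Delta and
gives a meaning to the case of an empty X. *)
Definition amalgam K X a b := foldr (fun x m => Num.min m (d a x + d x b)) K X.

Lemma amalgam_leK K X a b : amalgam K X a b <= K.
Proof. by elim: X => //= x X IH; rewrite ge_min IH. Qed.

Lemma amalgam_le K X a b x : x \in X -> amalgam K X a b <= d a x + d x b.
Proof.
elim: X => //= y X IH; rewrite inE ge_min => /predU1P[->|/IH ->//].
by rewrite lexx orbT.
Qed.

Lemma amalgam_cases K X a b : amalgam K X a b = K \/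
  exists2 x, x \in X & amalgam K X a b = d a x + d x b.
Proof.
rewrite /amalgam; elim: X => [|y X IH] /=; first by left.
case: IH => [->|[x xX ->]].
  have [_|_] := leP K; [by left | right].
  by exists y; rewrite ?mem_head.
have [_|_] := leP; right; first by exists x; rewrite // inE xX orbT.
by exists y; rewrite ?mem_head.
Qed.

Lemma le_amalgam K X a b t : t <= K -> {in X, forall x, t <= d a x + d x b} ->
  t <= amalgam K X a b.
Proof. by move=> tK tX; have [->//|[x xX ->]] := amalgam_cases K X a b; exact: tX. Qed.

Lemma amalgam_Delta K X a b : Delta K -> Delta (amalgam K X a b).
Proof.
move=> DK; elim: X => //= x X IH; apply: Delta_cap => //; exact: Delta_dist.
Qed.

Lemma amalgam_sym K X a b : amalgam K X a b = amalgam K X b a.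
Proof.
rewrite /amalgam; elim: X => //= x X ->.
by rewrite addrC [d a x]metric_sym [d x b]metric_sym.
Qed.

Lemma amalgam_lip K X a b c : amalgam K X a c <= d a b + amalgam K X b c.
Proof.
have [->|[x xX ->]] := amalgam_cases K X b c.
  by apply: le_trans (amalgam_leK _ _ _ _) _; rewrite lerDr mdist_ge0.
apply: le_trans (amalgam_le K _ _ xX) _.
by rewrite addrA lerD2r metric_triangle.
Qed.

Lemma admissible_amalgam K X A : Delta K -> {in A &, forall a b, d a b <= K} ->
  admissible A (amalgam K X).
Proof.
move=> DK AK; split=> [a b _ _|a b _ _|a b aA bA|a b c _ _ _].
- exact: amalgam_Delta.
- exact: amalgam_sym.
- by apply: le_amalgam => [|x _]; [exact: AK | exact: metric_triangle].
- exact: amalgam_lip.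
Qed.

(** With f and g the amalgamation distances over A cap B and over B, this
increases from g to f as s grows from a small value to K. *)
Definition interpolant (f g : U -> U -> R) s a b :=
  Num.min (f a b) (Num.max (g a b) s).

Lemma admissible_interpolant A f g s : admissible A f -> admissible A g ->
  Delta s -> admissible A (interpolant f g s).
Proof.
rewrite /interpolant => fA gA Ds; split=> [a b aA bA|a b aA bA|a b aA bA|a b c aA bA cA].
- have := adm_Delta fA aA bA; have := adm_Delta gA aA bA => Dg Df.
  by have [_|_] := leP (g a b) s; case: leP.
- by rewrite (adm_sym fA) // (adm_sym gA).
- by rewrite le_min le_max (adm_ge fA) // (adm_ge gA).
- have := adm_lip fA aA bA cA; have := adm_lip gA aA bA cA.
  have := mdist_ge0 a b; rewrite ge_min.
  have [h|h] := leP (f b c) (Num.max (g b c) s) => d0 Lg Lf; first by rewrite Lf.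
  apply/orP; right; rewrite ge_max; apply/andP; split.
    by apply: le_trans Lg _; rewrite lerD2l le_max lexx.
  by rewrite -[leLHS]add0r lerD // le_max lexx orbT.
Qed.

Lemma interpolant_mono f g s t a b : s <= t ->
  interpolant f g s a b <= interpolant f g t a b.
Proof.
move=> st; rewrite /interpolant le_min ge_min lexx /= ge_min; apply/orP; right.
by rewrite ge_max !le_max lexx st orbT.
Qed.

(** If both terms on the right are of the form max (g _ _) s, their sum is at
least 2 s and at least g a c; if one of them is given by f, the sum is at least f a c, since f is
1-Lipschitz and everything else dominates the distance. *)
Lemma interpolant_double A f g s t a b c : admissible A f -> admissible A g ->
  a \in A -> b \in A -> c \in A -> t <= s + s ->
  interpolant f g t a c <= interpolant f g s a b + interpolant f g s b c.
Proof.
move=> fA gA aA bA cA ts.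
have fd : f a c <= f a b + d b c.
  rewrite (adm_sym fA) // (adm_sym fA aA bA) addrC metric_sym.
  exact: (adm_lip fA).
have df : f a c <= d a b + f b c by exact: (adm_lip fA).
have gg : g a c <= g a b + g b c.
  by apply: le_trans (adm_lip gA aA bA cA) _; rewrite lerD2r (adm_ge gA).
have := adm_ge fA aA bA; have := adm_ge fA bA cA.
have := adm_ge gA aA bA; have := adm_ge gA bA cA.
rewrite /interpolant => g1 g2 f1 f2.
rewrite ge_min.
have [h1|h1] := leP (f a b); have [h2|h2] := leP (f b c).
- by apply/orP; left; lra.
- apply/orP; left; apply: le_trans fd _; rewrite lerD2l.
  by rewrite le_max g1.
- apply/orP; left; apply: le_trans df _; rewrite lerD2r.
  by rewrite le_max g2.
- apply/orP; right; rewrite ge_max; apply/andP; split.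
    by apply: le_trans gg _; rewrite lerD // le_max lexx.
  by apply: le_trans ts _; rewrite lerD // le_max lexx orbT.
Qed.

Lemma interpolant_top K B C a b :
  interpolant (amalgam K C) (amalgam K B) K a b = amalgam K C a b.
Proof.
rewrite /interpolant; apply/min_idPl.
by rewrite le_max amalgam_leK orbT.
Qed.

(** Take for s the least distance from A to a point of B outside A, if it is less
than K.  A path from a to b through such a point has length at least s, so an
amalgamation distance over B which is below s is attained at a point of
A cap B. *)
Lemma interpolant_bottom A B K : Delta K ->
  exists s, [/\ Delta s, s <= K, 0 < s \/ s = K &
    {in A &, forall a b,
      interpolant (amalgam K [seq x <- A | x \in B]) (amalgam K B) s a b =
      amalgam K B a b}].
Proof.
move=> DK.
pose D := [seq d ab.1 ab.2 | ab <- [seq (a, b) | a <- A, b <- B] & ab.2 \notin A].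
have DP t : t \in D -> Delta t /\ 0 < t.
  move=> /mapP[[a b]]; rewrite mem_filter /= => /andP[bA].
  move=> /allpairsP[[a' b'] /= [aA _ [ea eb]]] ->.
  split; first exact: Delta_dist.
  by rewrite mdist_gt0; apply: contraNneq bA => <-; rewrite ea.
have [s [Ds sK s0 sD]] : exists s, [/\ Delta s, s <= K, 0 < s \/ s = K &
    {in D, forall t, s <= t}].
  elim: D DP => [_|t D IH DP].
    by exists K; split=> //; right.
  have [|s [Ds sK s0 sD]] := IH.
    by move=> u uD; apply: DP; rewrite inE uD orbT.
  have [Dt t0] := DP t (mem_head _ _).
  exists (Num.min t s); split.
  - by have [_|_] := leP t s.
  - by rewrite ge_min sK orbT.
  - by have [_|_] := leP t s => //; left.
  - move=> u; rewrite inE ge_min => /predU1P[->|/sD ->]; rewrite ?lexx ?orbT //.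
exists s; split=> // a b aA bA; rewrite /interpolant.
have gf : amalgam K B a b <= amalgam K [seq x <- A | x \in B] a b.
  apply: le_amalgam => [|x]; first exact: amalgam_leK.
  by rewrite mem_filter => /andP[xB _]; exact: amalgam_le.
apply/eqP; rewrite eq_le; apply/andP; split; last first.
  by rewrite le_min gf le_max lexx.
have [sg|gs] := leP s (amalgam K B a b); first by rewrite ge_min lexx orbT.
rewrite ge_min; apply/orP; left.
have [->|[x xB ex]] := amalgam_cases K B a b; first exact: amalgam_leK.
rewrite ex; apply: amalgam_le; rewrite mem_filter xB.
apply: contraTT gs => xA; rewrite -leNgt ex.
apply: le_trans (sD (d a x) _) _; last by rewrite lerDl mdist_ge0.
by apply/mapP; exists (a, x) => //; rewrite mem_filter xA; apply/allpairsP; exists (a, x).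
Qed.

(** Since the elements of L fix C, a point of C is at the same distance from a
and from k a; so the amalgamation distance over C satisfies the triangle
inequalities with all the translates k A at once, provided that K bounds the
distances between these translates. *)
Lemma free_copy A C K (L : seq G) : {subset C <= A} -> Delta K ->
  {in A &, forall a b, d a b <= K} ->
  {in L &, forall k l, {in A &, forall a b, d (isom_fun k a) (isom_fun l b) <= K}} ->
  {in L, forall k, {in C, forall c, isom_fun k c = c}} ->
  exists h : G, {in L, forall k, mutual A (amalgam K C) k h}.
Proof.
move=> CA DK AK LK LC.
have fA := admissible_amalgam C DK AK.
pose J := [seq (k, a) | k <- L, a <- A].
have JP k a : (k, a) \in J -> k \in L /\ a \in A.
  by case/allpairsP => -[k' a'] /= [kL aA [-> ->]].
pose x (t : G * U) := isom_fun t.1 t.2.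
have xC k a c : k \in L -> c \in C -> d (isom_fun k a) c = d a c.
  by move=> kL cC; rewrite -[in LHS](LC _ kL _ cC) isom_funP.
have lip k l a b c : k \in L -> l \in L ->
    amalgam K C a b <= d (isom_fun k b) (isom_fun l c) + amalgam K C a c.
  move=> kL lL; have [->|[y yC ->]] := amalgam_cases K C a c.
    by apply: le_trans (amalgam_leK _ _ _ _) _; rewrite lerDr mdist_ge0.
  apply: le_trans (amalgam_le K _ _ yC) _.
  rewrite addrCA lerD2l metric_sym -(xC k b y) // addrC [d y c]metric_sym -(xC l c y) //.
  by rewrite addrC metric_triangle.
have [|||||h hP] := @copy_extension _ J x A (fun a t => amalgam K C a t.2).
- by move=> a [k b] _ _; exact: amalgam_Delta.
- by move=> a aA [k b] [l c] /JP[kL bA] /JP[lL cA]; exact: lip.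
- move=> a aA [k b] [l c] /JP[kL bA] /JP[lL cA]; rewrite /x /=.
  have [->|[y yC ->]] := amalgam_cases K C a b.
    apply: (le_trans (LK k l kL lL b c bA cA)).
    by rewrite lerDl (le_trans (mdist_ge0 a c)) // (adm_ge fA).
  have [->|[z zC ->]] := amalgam_cases K C a c.
    apply: (le_trans (LK k l kL lL b c bA cA)).
    by rewrite lerDr addr_ge0 ?mdist_ge0.
  have := metric_triangle (isom_fun k b) y (isom_fun l c).
  have := metric_triangle y z (isom_fun l c).
  rewrite (xC k b y) // [d z (isom_fun l c)]metric_sym (xC l c z) //.
  have := metric_triangle y a z; rewrite [d y a]metric_sym.
  by rewrite [d b y]metric_sym [d c z]metric_sym; lra.
- by move=> a b aA bA [k c] _; exact: amalgam_lip.
- by move=> a b aA bA [k c] /JP[_ cA]; exact: (adm_triangle fA).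
exists h => k kL a b aA bA; rewrite metric_sym (hP b (k, a)) //=.
  exact: amalgam_sym.
by apply/allpairsP; exists (k, a).
Qed.

End Urysohn.

(** * Dissociation: orthogonality of spaces of fixed vectors *)

Lemma mem_cat_l (T : eqType) (s t : seq T) x : x \in s -> x \in s ++ t.
Proof. by rewrite mem_cat => ->. Qed.

Lemma mem_cat_r (T : eqType) (s t : seq T) x : x \in t -> x \in s ++ t.
Proof. by rewrite mem_cat orbC => ->. Qed.

Section Gram.
Context {R : realType} {H : hilbertType R}.

Lemma rdot_suml (y : nat -> H) z n :
  rdot (\sum_(i < n) y i) z = \sum_(i < n) rdot (y i) z.
Proof.
elim: n => [|n IH]; first by rewrite !big_ord0 rdot0l.
by rewrite !big_ord_recr /= rdotDl IH.
Qed.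

Lemma sqnorm_sum_gram (y : nat -> H) (a b : R) n :
  (forall i, (i < n)%N -> sqnorm (y i) = a) ->
  (forall i j, (i < j)%N -> (j < n)%N -> rdot (y i) (y j) = b) ->
  sqnorm (\sum_(i < n) y i) = n%:R * a + n%:R * (n%:R - 1) * b.
Proof.
elim: n => [|n IH] ya yb; first by rewrite big_ord0 /sqnorm rdot0l; lra.
rewrite big_ord_recr /= sqnormD.
rewrite (IH (fun i ni => ya i (leqW ni)) (fun i j ij jn => yb i j ij (leqW jn))).
rewrite rdot_suml (eq_bigr (fun=> b)); last by move=> i _; apply: yb.
by rewrite sumr_const card_ord ya // -mulr_natl -natr1; ring.
Qed.

(** The squared norm n a + n (n - 1) b of the sum of the vectors is nonnegative
for all n. *)
Lemma gram_ge0 (a b : R) :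
  (forall n, exists y : nat -> H, (forall i, (i < n)%N -> sqnorm (y i) = a) /\
    (forall i j, (i < j)%N -> (j < n)%N -> rdot (y i) (y j) = b)) ->
  0 <= b.
Proof.
move=> yP; rewrite leNgt; apply/negP => b0.
pose n := (Num.truncn (`|a| / - b)).+2.
have [y [ya yb]] := yP n.
have := sqnorm_ge0 (\sum_(i < n) y i); rewrite (sqnorm_sum_gram ya yb).
have n0 : 0 < n%:R :> R by rewrite ltr0n.
rewrite -mulrA -mulrDr pmulr_rge0 //.
have : `|a| / - b < n%:R - 1.
  by rewrite /n -natr1 addrK; exact: truncnS_gt.
rewrite ltr_pdivrMr ?oppr_gt0 // mulrN.
have := ler_norm a; lra.
Qed.

End Gram.

Section Representation.
Context {R : realType} (Delta : set R) (U : metricType R).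
Hypotheses (Dset : distance_set Delta) (Uurysohn : urysohn_space Delta U).
Context {H : hilbertType R} (pi : Isom U -> H -> H).
Local Notation G := (Isom U).
Local Notation d := (@mdist R U).
Hypotheses (piU : forall g, unitary (pi g)) (pi1 : pi 1%g = id)
  (piM : forall g h, pi (g * h)%g = pi g \o pi h).
Implicit Types (A B C X : seq U) (x y xi eta : H) (g h k : G).

Definition stab X : set G := [set g | {in X, forall u, isom_fun g u = u}].

Definition fixed X : set H := [set v | forall g, stab X g -> pi g v = v].

Lemma pi1E x : pi 1%g x = x.
Proof. by rewrite pi1. Qed.

Lemma pi_linear g : linear (pi g).
Proof. by case: (piU g). Qed.

Lemma pi_dot g x y : '[pi g x, pi g y] = '[x, y].
Proof. by case: (piU g). Qed.

Lemma pi_rdot g x y : rdot (pi g x) (pi g y) = rdot x y.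
Proof. by rewrite /rdot pi_dot. Qed.

Lemma pi_sqnorm g x : sqnorm (pi g x) = sqnorm x.
Proof. exact: pi_rdot. Qed.

Lemma piVK g : cancel (pi g^-1%g) (pi g).
Proof. by move=> x; rewrite -[LHS]/((pi _ \o pi _) x) -piM mulgV pi1. Qed.

Lemma piME g h x : pi (g * h)%g x = pi g (pi h x).
Proof. by rewrite piM. Qed.

Lemma fixed_agree A xi g h : fixed A xi ->
  {in A, isom_fun g =1 isom_fun h} -> pi g xi = pi h xi.
Proof.
move=> xiA gh; rewrite -[xi in LHS](xiA (g^-1 * h)%g) ?piME ?piVK //.
move=> a aA; apply: (@isom_fun_inj _ _ g).
rewrite (gh a aA); exact: isom_inv_funK.
Qed.

(** Some isometry k carries (g' A, h' B) to (g A, h B); since xi and eta are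
fixed by the pointwise stabilizers of A and B, pi k maps the second pair of
vectors to the first. *)
Lemma dot_mutual A B xi eta g h g' h' : fixed A xi -> fixed B eta ->
  {in A & B, forall a b, d (isom_fun g a) (isom_fun h b) =
                         d (isom_fun g' a) (isom_fun h' b)} ->
  rdot (pi g xi) (pi h eta) = rdot (pi g' xi) (pi h' eta).
Proof.
move=> xiA etaB gh; have [k [kA kB]] := joint_extension Uurysohn gh.
rewrite -(pi_rdot k (pi g' xi)) -!piME; congr rdot.
  by apply: (fixed_agree xiA) => a aA; rewrite -kA.
by apply: (fixed_agree etaB) => b bB; rewrite -kB.
Qed.

Section Orthogonality.
Variables (A : seq U) (xi : H).
Hypothesis xiA : fixed A xi.
Local Notation mutual := (mutual A).
Local Notation admissible := (admissible Delta A).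

Lemma exists_mutual rho : admissible rho -> exists g h, mutual rho g h.
Proof.
move=> rhoP.
have [||||| g [gP _]] := @exists_copies _ _ _ Dset Uurysohn A [::]
    (fun _ _ => rho) 2.
- by [].
- by [].
- move=> _ _ _ a b c aA bA cA; apply: le_trans (adm_lip rhoP aA bA cA) _.
  by rewrite lerD2r (adm_ge rhoP).
- by [].
- by [].
by exists (g 0%N), (g 1%N); exact: gP.
Qed.

(** Take 2 n copies of A such that two of them are at distances rho true if
their indices have the same parity, and rho false otherwise.  The n differences of
consecutive vectors pi(g_i) xi have constant mutual inner products, equal to twice
the difference of both sides, which is nonnegative by [gram_ge0]. *)
Lemma gram_le (rho : bool -> U -> U -> R) g h g' h' :
  (forall e, admissible (rho e)) ->
  (forall e e' e'' a b c, a \in A -> b \in A -> c \in A ->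
     rho e a c <= rho e' a b + rho e'' b c) ->
  mutual (rho true) g h -> mutual (rho false) g' h' ->
  rdot (pi g' xi) (pi h' xi) <= rdot (pi g xi) (pi h xi).
Proof.
move=> rhoP rho3 gh gh'.
set t := rdot (pi g xi) _; set t' := rdot _ _.
suff : 0 <= 2 * t - 2 * t' by lra.
apply: (@gram_ge0 R H (2 * sqnorm xi - 2 * t')) => n.
have [||||| k [kP _]] := @exists_copies _ _ _ Dset Uurysohn A [::]
    (fun i j => rho (odd i == odd j)) n.*2.
- by [].
- by move=> i j; rewrite eq_sym.
- by move=> i j l a b c; exact: rho3.
- by [].
- by [].
pose x i := pi (k i) xi.
have xt i j : (i < n.*2)%N -> (j < n.*2)%N -> i <> j -> odd i == odd j ->
    rdot (x i) (x j) = t.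
  move=> ni nj ij oij; apply: (dot_mutual xiA xiA) => a b aA bA.
  by rewrite gh // (kP _ _ ni nj ij a b aA bA) oij.
have xt' i j : (i < n.*2)%N -> (j < n.*2)%N -> i <> j -> odd i != odd j ->
    rdot (x i) (x j) = t'.
  move=> ni nj ij /negPf oij; apply: (dot_mutual xiA xiA) => a b aA bA.
  by rewrite gh' // (kP _ _ ni nj ij a b aA bA) oij.
have even_lt m : (m < n)%N -> (m.*2 < n.*2)%N by rewrite ltn_double.
have odd_lt m : (m < n)%N -> (m.*2.+1 < n.*2)%N by rewrite ltn_Sdouble.
exists (fun i => x i.*2 - x i.*2.+1); split=> [i ni|i j ij nj].
  rewrite sqnormB !pi_sqnorm xt' /= ?odd_double ?even_lt ?odd_lt //; lra.
have ni := ltn_trans ij nj.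
have neq m l : m./2 != l./2 -> m <> l by move=> + e; rewrite e eqxx.
have ij2 : i != j by rewrite ltn_eqF.
rewrite rdotDl !rdotDr !rdotNl !rdotNr.
rewrite (xt i.*2 j.*2) ?(xt' i.*2 j.*2.+1) ?(xt' i.*2.+1 j.*2) ?(xt i.*2.+1 j.*2.+1);
  rewrite /= ?odd_double ?even_lt ?odd_lt //; first lra.
all: by apply: neq; rewrite /= ?uphalf_double ?doubleK.
Qed.

(** Any three distances taken among rho and rho' satisfy the triangle
inequalities, so [gram_le] applies to the bipartite pattern and also to the
complementary one. *)
Lemma gram_eq (rho rho' : U -> U -> R) g h g' h' :
  admissible rho -> admissible rho' ->
  {in A &, forall a b, rho a b <= rho' a b} ->
  (forall a b c, a \in A -> b \in A -> c \in A -> rho' a c <= rho a b + rho b c) ->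
  mutual rho g h -> mutual rho' g' h' ->
  rdot (pi g' xi) (pi h' xi) = rdot (pi g xi) (pi h xi).
Proof.
move=> rhoP rhoP' le_rho rho3 gh gh'; pose rhos (e : bool) := if e then rho else rho'.
have rhosP e : admissible (rhos e) by case: e.
have rhos3 e e' e'' a b c : a \in A -> b \in A -> c \in A ->
    rhos e a c <= rhos e' a b + rhos e'' b c.
  move=> aA bA cA; have := le_rho a c aA cA; have := rho3 a b c aA bA cA.
  have := le_rho a b aA bA; have := le_rho b c bA cA.
  case: e e' e'' => [] [] [] /=; lra.
apply/eqP; rewrite eq_le; apply/andP; split.
  exact: (@gram_le rhos).
apply: (@gram_le (rhos \o negb) g' h' g h _ _ gh' gh) => [e|e e' e'' a b c].
  exact: rhosP.
exact: rhos3.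
Qed.

Lemma interpolant_gram f f' s0 K g h g' h' : admissible f -> admissible f' ->
  Delta s0 -> Delta K -> s0 <= K -> 0 < s0 \/ s0 = K ->
  mutual (interpolant f f' s0) g h -> mutual (interpolant f f' K) g' h' ->
  rdot (pi g' xi) (pi h' xi) = rdot (pi g xi) (pi h xi).
Proof.
move=> fA gA Ds DK sK s0P gh; move: g' h'.
pose P s := forall g' h', mutual (interpolant f f' s) g' h' ->
  rdot (pi g' xi) (pi h' xi) = rdot (pi g xi) (pi h xi).
suff: P K by exact.
apply: (doubling Dset Ds DK sK s0P).
  by move=> g' h' gh'; apply: (dot_mutual xiA xiA) => a b aA bA; rewrite gh // gh'.
move=> s t Dsr Dtr s_gt0 st ts Ps g' h' gh'.
have [g1 [h1 gh1]] := exists_mutual (admissible_interpolant fA gA Dsr).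
rewrite -(Ps _ _ gh1); apply: gram_eq gh1 gh'.
- exact: admissible_interpolant.
- exact: admissible_interpolant.
- by move=> a b _ _; exact: interpolant_mono.
- by move=> a b c aA bA cA; exact: (interpolant_double fA gA).
Qed.

(** By the Cauchy-Schwarz inequality with eta for the sum of n vectors
pi(g_i) xi: the copies g_i A are free from each other over B, and all these
vectors have the same inner product with eta. *)
Lemma dot_le_gram B eta K g h : fixed B eta -> Delta K ->
  {in A ++ B &, forall a b, d a b <= K} -> mutual (amalgam K B) g h ->
  rdot xi eta ^+ 2 <= rdot (pi g xi) (pi h xi) * sqnorm eta.
Proof.
move=> etaB DK KP gh; set t := rdot (pi g xi) _.
have AK : {in A &, forall a b, d a b <= K}.
  by move=> a b aA bA; apply: KP; rewrite mem_cat ?aA ?bA.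
have fA := admissible_amalgam Dset Uurysohn B DK AK.
suff hN n : n.+1%:R * (rdot xi eta ^+ 2 - t * sqnorm eta) <=
    (sqnorm xi - t) * sqnorm eta.
  rewrite -subr_le0 leNgt; apply/negP => p0.
  have := hN (Num.truncn ((sqnorm xi - t) * sqnorm eta /
    (rdot xi eta ^+ 2 - t * sqnorm eta))).
  by rewrite -ler_pdivlMr // leNgt truncnS_gt.
have [||||| k [kP kB]] := @exists_copies _ _ _ Dset Uurysohn A B
    (fun _ _ => amalgam K B) n.+1.
- by [].
- by [].
- move=> _ _ _ a b c aA bA cA; apply: le_trans (adm_lip fA aA bA cA) _.
  by rewrite lerD2r (adm_ge fA).
- by move=> _ _ b bB a c aA cA; exact: amalgam_le.
- move=> _ _ b bB a c aA cA.
  have [->|[x xB ->]] := amalgam_cases K B a c.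
    by rewrite ler_wpDr ?mdist_ge0 // KP // mem_cat ?aA ?bB ?orbT.
  by rewrite -addrA (le_trans (metric_triangle a x b)) // lerD2l metric_triangle.
pose x i := pi (k i) xi.
have xt i j : (i < j)%N -> (j < n.+1)%N -> rdot (x i) (x j) = t.
  move=> ij nj; apply: (dot_mutual xiA xiA) => a b aA bA.
  rewrite gh // (kP i j (ltn_trans ij nj) nj _ a b aA bA) //.
  by move/eqP; rewrite ltn_eqF.
have xe i : (i < n.+1)%N -> rdot (x i) eta = rdot xi eta.
  move=> ni; have := @dot_mutual A B xi eta (k i) 1%g 1%g 1%g xiA etaB.
  by rewrite pi1; apply=> a b aA bB; rewrite kB.
have := rdot_CauchySchwarz (\sum_(i < n.+1) x i) eta.
rewrite rdot_suml (eq_bigr (fun=> rdot xi eta)); last by move=> i _; apply: xe.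
rewrite sumr_const card_ord -[rdot _ _ *+ _]mulr_natl.
rewrite (@sqnorm_sum_gram _ _ x (sqnorm xi) t); last 2 first.
- by move=> i _; exact: pi_sqnorm.
- exact: xt.
move=> cs; rewrite -(@ler_pM2l _ n.+1%:R) ?ltr0n //.
move: (n.+1%:R) cs => N; lra.
Qed.

(** The set Q of all v whose inner product with pi(h) xi is as close as wished to
that of xi, when h A is free enough over C, is closed and convex; it
contains the orbit of xi under the stabilizer of C, hence 0. *)
Lemma gram_small C (e : R) : {subset C <= A} ->
  hull [set pi g xi | g in stab C] 0 -> 0 < e ->
  exists (L : seq G) D, [/\ {in L, forall k, stab C k}, Delta D &
    forall K, Delta K -> D <= K -> forall h,
      {in L, forall k, mutual (amalgam K C) k h} -> `|rdot xi (pi h xi)| <= e].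
Proof.
move=> CA.
pose Q : set H := [set v | forall e : R, 0 < e -> exists (L : seq G) D,
  [/\ {in L, forall k, stab C k}, Delta D & forall K, Delta K -> D <= K ->
    forall h, {in L, forall k, mutual (amalgam K C) k h} ->
    `|rdot (xi - v) (pi h xi)| <= e]].
suff QP : hull [set pi g xi | g in stab C] `<=` Q.
  by move=> /QP Q0 e0; have := Q0 e e0; rewrite subr0.
move=> v hv; apply: hv => {v}.
- move=> v vP {}e e0.
  pose dl := (e / 2) ^+ 2 / (sqnorm xi + 1).
  have n0 := sqnorm_ge0 xi.
  have dl0 : 0 < dl by rewrite divr_gt0 ?exprn_gt0 ?divr_gt0 //; lra.
  have [w Qw vw] := vP dl dl0.
  have [|L [D [LC DD LP]]] := Qw (e / 2); first by rewrite divr_gt0.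
  exists L, D; split=> // K DK DlK h hL.
  have := LP K DK DlK h hL.
  have -> : xi - v = (xi - w) + (w - v) by rewrite addrA subrK.
  rewrite (rdotDl (xi - w)) => small.
  suff : `|rdot (w - v) (pi h xi)| <= e / 2.
    by have := ler_normD (rdot (xi - w) (pi h xi)) (rdot (w - v) (pi h xi)); lra.
  rewrite -(@ler_pXn2r _ 2) ?nnegrE //; last by lra.
  rewrite real_normK ?num_real //; apply: le_trans (rdot_CauchySchwarz _ _) _.
  rewrite pi_sqnorm sqnorm_distC; have := sqnorm_ge0 (v - w); move: vw.
  rewrite /dl ltr_pdivlMr; last by lra.
  nra.
- move=> v w Qv Qw {}e e0.
  have [L [D [LC DD LP]]] := Qv e e0.
  have [L' [D' [LC' DD' LP']]] := Qw e e0.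
  exists (L ++ L'), (Num.max D D'); split.
  + by move=> k; rewrite mem_cat => /orP[/LC|/LC'].
  + by have [_|_] := leP D D'.
  + move=> K DK; rewrite ge_max => /andP[DK1 DK2] h hL.
    have := LP' K DK DK2 h (fun k kL => hL k (mem_cat_r _ kL)).
    have := LP K DK DK1 h (fun k kL => hL k (mem_cat_l _ kL)).
    rewrite sub_midpoint rdotZl (rdotDl (xi - v)) normrM [`|2^-1|]ger0_norm ?invr_ge0 //.
    have := ler_normD (rdot (xi - v) (pi h xi)) (rdot (xi - w) (pi h xi)).
    lra.
- move=> _ [k kC <-] {}e e0; exists [:: k; 1%g], 0; split.
  + by move=> l; rewrite !inE => /orP[]/eqP->.
  + exact: Delta0.
  + move=> K DK _ h hL; rewrite rdotDl rdotNl.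
    have -> : rdot xi (pi h xi) = rdot (pi k xi) (pi h xi); last first.
      by rewrite subrr normr0 ltW.
    rewrite -[X in rdot X _]pi1E; apply: (dot_mutual xiA xiA) => a b aA bA.
    by rewrite !hL // !inE eqxx ?orbT.
Qed.

(** The amalgamation distances over B and over A cap B, with a common truncation
K, give the same inner product by [interpolant_gram].  The first one bounds the
inner product of xi and eta, the second one is small once K is large. *)
Lemma orthogonal_fixed B eta : fixed B eta ->
  hull [set pi g xi | g in stab [seq x <- A | x \in B]] 0 -> rdot xi eta = 0.
Proof.
move=> etaB; set C := [seq x <- A | x \in B] => h0.
have CA : {subset C <= A} by move=> x; rewrite mem_filter => /andP[].
suff eP (e : R) : 0 < e -> rdot xi eta ^+ 2 <= e * sqnorm eta.
  apply/eqP; rewrite -sqrf_eq0 eq_le sqr_ge0 andbT; apply/ler_addgt0Pl => e e0.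
  have eta0 : 0 < sqnorm eta + 1 by have := sqnorm_ge0 eta; lra.
  rewrite addr0; apply: le_trans (eP (e / (sqnorm eta + 1)) _) _.
    by rewrite divr_gt0.
  by rewrite mulrAC ler_pdivrMr // ler_pM2l //; lra.
move=> e0; have [L [D [LC DD LP]]] := gram_small CA h0 e0.
pose L1 := 1%g :: L.
have [K [DK DlK KP]] := dist_bound Uurysohn
  (A ++ B ++ [seq isom_fun k a | k <- L1, a <- A]) DD.
have AK : {in A &, forall a b, d a b <= K}.
  by move=> a b aA bA; apply: KP; rewrite mem_cat ?aA ?bA.
have AP X := admissible_amalgam Dset Uurysohn X DK AK.
have [h hL] : exists h : G, {in L1, forall k, mutual (amalgam K C) k h}.
  apply: (free_copy Dset Uurysohn) => //.
  - have inL k a : k \in L1 -> a \in A ->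
        isom_fun k a \in A ++ B ++ [seq isom_fun k a | k <- L1, a <- A].
      move=> kL aA; do 2! apply: mem_cat_r.
      by apply/allpairsP; exists (k, a).
    by move=> k l kL lL a b aA bA; apply: KP; exact: inL.
  - by move=> k; rewrite inE => /predU1P[->//|/LC]; exact.
have {LP} := LP K DK DlK h (fun k kL => hL k (@mem_cat_r _ [:: 1%g] L k kL)).
have [s [Ds sK s0 sE]] := interpolant_bottom Uurysohn A B DK.
have [g1 [h1 gh1]] := exists_mutual (AP B).
have -> : rdot xi (pi h xi) = rdot (pi g1 xi) (pi h1 xi).
  rewrite -[X in rdot X _]pi1E.
  apply: (@interpolant_gram (amalgam K C) (amalgam K B) s K g1 h1) => //.
  - by move=> a b aA bA; rewrite sE // gh1.
  - by move=> a b aA bA; rewrite interpolant_top // hL // mem_head.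
move=> small.
have KAB : {in A ++ B &, forall a b, d a b <= K}.
  by move=> a b aAB bAB; apply: KP; rewrite catA mem_cat ?aAB ?bAB.
apply: le_trans (dot_le_gram etaB DK KAB gh1) _.
rewrite ler_wpM2r ?sqnorm_ge0 //; exact: le_trans (ler_norm _) small.
Qed.

End Orthogonality.

End Representation.

(** * The von Neumann algebra generated by a representation *)

Section VonNeumann.
Context {R : realType} (Delta : set R) (U : metricType R).
Hypotheses (Dset : distance_set Delta) (Uurysohn : urysohn_space Delta U).
Context {H : hilbertType R} (pi : Isom U -> H -> H).
Local Notation G := (Isom U).
Hypotheses (piU : forall g, unitary (pi g)) (pi1 : pi 1%g = id)
  (piM : forall g h, pi (g * h)%g = pi g \o pi h)
  (piC : forall x (e : R), 0 < e ->
     exists X : seq U, forall g, stab X g -> sqnorm (pi g x - x) < e).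
Implicit Types (A B C X : seq U) (x y v : H) (g h k : G).

Local Notation M := (commutant (commutant (range pi))).
Local Notation fixed := (fixed pi).

Let pi_lin := pi_linear piU.
Let pi_sq := pi_sqnorm piU.
Let pi_rd := pi_rdot piU.
Let pi_d := pi_dot piU.
Let pi_mul := piME piM.
Let pi_VK := piVK pi1 piM.

Lemma pi_adj g x y : '[pi g x, y] = '[x, pi g^-1%g y].
Proof. by rewrite -[y in LHS](pi_VK g) pi_d. Qed.

Lemma stabM X g h : stab X g -> stab X h -> stab X (g * h)%g.
Proof.
move=> gX hX u uX; rewrite -[LHS]/(isom_fun g (isom_fun h u)).
by rewrite (hX u uX) (gX u uX).
Qed.

Lemma subspace_fixed X : linear_subspace (fixed X).
Proof.
split=> [g _|a x y xX yX g gX]; first exact: linear_op0.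
by rewrite (linear_opD (pi_lin g)) (linear_opZ (pi_lin g)) xX ?yX.
Qed.

Lemma pi_bounded g : bounded_operator (pi g).
Proof.
by apply/bounded_operatorP; split=> //; apply: continuous_at0_le => x; rewrite pi_sq.
Qed.

Lemma norm_closed_kernel (T : H -> H) : bounded_operator T ->
  norm_closed [set x | T x = 0].
Proof.
move=> /bounded_operatorP[lT cT]; apply: (norm_closed_preimage lT cT (Q := [set 0])).
move=> x xP /=; apply: sqnorm_eq0; apply/eqP; rewrite eq_le sqnorm_ge0 andbT.
apply/ler_addgt0Pl => e e0; have [y -> ] := xP e e0.
by rewrite subr0 addr0 => /ltW.
Qed.

Lemma norm_closed_fixed_by (T : H -> H) : bounded_operator T ->
  norm_closed [set x | T x = x].
Proof.
move=> bT; have bT' := bounded_lin (-1) bounded_id bT.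
have -> : [set x | T x = x] = [set x | -1 *: id x + T x = 0].
  apply/seteqP; split=> x /=; rewrite scaleN1r addrC.
    by move=> ->; rewrite subrr.
  by move=> /eqP; rewrite subr_eq0 => /eqP.
exact: norm_closed_kernel.
Qed.

Lemma midconvex_fixed_by (T : H -> H) : linear T -> midconvex [set x | T x = x].
Proof.
by move=> lT x y /= xT yT; rewrite (linear_opZ lT) (linear_opD lT) xT yT.
Qed.

Lemma norm_closed_fixed X : norm_closed (fixed X).
Proof.
move=> x xP g gX; apply: (norm_closed_fixed_by (pi_bounded g)) => e /xP[y yX xy].
by exists y => //; exact: yX.
Qed.

Lemma fixed_hull X x : exists2 m, fixed X m & hull [set pi g x | g in stab X] m.
Proof.
have [||| m mP hm] := @fixed_in_hull _ _ [set pi g | g in stab X] x.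
- by exists 1%g.
- by move=> _ [g gX <-]; split.
- move=> _ _ [g gX <-] [h hX <-]; exists (g * h)%g; last exact: piM.
  exact: stabM.
exists m; first by move=> g gX; apply: mP; exists g.
move=> Q Qc Qm QP; apply: hm => // _ [_ [g gX <-] <-]; apply: QP; by exists g.
Qed.

(** All vectors pi(g) x, g in the stabilizer of X, have the same inner product
with a vector fixed by this stabilizer. *)
Lemma hull_fixed_orth X x m : hull [set pi g x | g in stab X] m ->
  forall f, fixed X f -> '[x - m, f] = 0.
Proof.
move=> hm f fX.
have h u : fixed X u -> rdot (x - m) u = 0.
  move=> uX; rewrite rdotDl rdotNl (hull_rdot_eq (c := rdot x u) _ hm) ?subrr //.
  by move=> _ [g gX <-]; rewrite -[in LHS](uX g gX) pi_rd.
apply/dot_eq0P; split; apply: h => //.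
by rewrite -[_ *: _]addr0; apply: (subspace_fixed X).2 => //; exact: (subspace_fixed X).1.
Qed.

Section FixedProjection.
Variables (X : seq U) (p : H -> H).
Hypothesis pP : orthogonal_projection (fixed X) p.

(** The vector p x is the fixed point in the closed convex hull of the orbit of x,
and T carries this hull into that of the orbit of T x.  This shows that p lies in
the bicommutant with no recourse to the adjoint of T. *)
Lemma proj_fixed_commutant (T : H -> H) x : commutant (range pi) T ->
  p (T x) = T (p x).
Proof.
move=> CT; have /bounded_operatorP[lT cT] := commutant_bounded CT.
have Tpi g y : T (pi g y) = pi g (T y) by apply: (commutant_comm _ CT); exists g.
have [m mX hm] := fixed_hull X x.
have -> : p x = m.
  by apply: (proj_uniq (subspace_fixed X) pP) => //; exact: hull_fixed_orth.
apply: (proj_uniq (subspace_fixed X) pP).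
  by move=> g gX; rewrite -Tpi mX.
apply: hull_fixed_orth => Q Qc Qm QP.
apply: (hm (T @^-1` Q)).
- exact: norm_closed_preimage.
- exact: midconvex_preimage.
- by move=> _ [g gX <-] /=; rewrite Tpi; apply: QP; exists g.
Qed.

Lemma proj_fixed_M : M p.
Proof.
split; first exact: (proj_bounded (subspace_fixed X) pP).
by move=> T CT; apply/funext => x /=; exact: proj_fixed_commutant.
Qed.

End FixedProjection.

Lemma commutant_pi_linear V : commutant (range pi) V -> linear V.
Proof. by case=> -[]. Qed.

Lemma M_pi g : M (pi g).
Proof. by apply: sub_bicommutant; [exact: pi_bounded | exists g]. Qed.

Lemma M_linear T : M T -> linear T.
Proof. by case=> -[]. Qed.

Section Central.
Variable Z : H -> H.
Hypotheses (Zc : central_projection M Z) (Z0 : Z <> cst 0).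

Let MZ : M Z. Proof. by case: Zc => -[]. Qed.
Let lZ := M_linear MZ.
Let ZZ x : Z (Z x) = Z x.
Proof. by case: Zc => -[_ ZZ _] _; rewrite -[LHS]/((Z \o Z) x) ZZ. Qed.
Let Z_sa : self_adjoint Z. Proof. by case: Zc => -[_ _ sa] _. Qed.
Let ZC T x : M T -> Z (T x) = T (Z x).
Proof. by move=> MT; case: Zc => _ ZC; rewrite -[LHS]/((Z \o T) x) ZC. Qed.

Lemma hull_in_Z X x m : Z x = x -> hull [set pi g x | g in stab X] m -> Z m = m.
Proof.
move=> Zx hm; apply: (hm [set x | Z x = x]).
- by apply: norm_closed_fixed_by; exact: commutant_bounded MZ.
- exact: midconvex_fixed_by.
- by move=> _ [g gX <-] /=; rewrite ZC ?Zx //; exact: M_pi.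
Qed.

(** If pi(g) moves Z x by less than its norm for all g in the stabilizer of X,
then the orbit of Z x stays in a half-space which does not contain 0. *)
Lemma exists_fixed : exists X x, [/\ fixed X x, Z x = x & x <> 0].
Proof.
have [x Zx0] : exists x, Z x <> 0.
  apply: contra_notP Z0 => /forallNP Z0'; apply/funext => x.
  by apply: contrapT; exact: Z0'.
have n0 : 0 < sqnorm (Z x).
  rewrite lt_neqAle sqnorm_ge0 andbT eq_sym; apply/eqP => /sqnorm_eq0.
  exact: Zx0.
have [X XP] := piC (Z x) n0.
have [m mX hm] := fixed_hull X (Z x).
exists X, m; split=> //; first exact: hull_in_Z hm.
move=> m0; have : sqnorm (Z x) / 2 <= rdot m (Z x).
  apply: hull_rdot_ge hm => _ [g gX <-].
  by have := XP g gX; rewrite sqnormB pi_sq; lra.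
by rewrite m0 rdot0l; lra.
Qed.

Lemma exists_minimal_fixed : exists A,
  [/\ uniq A, exists x, [/\ fixed A x, Z x = x & x <> 0] &
     forall B x, (size B < size A)%N -> fixed B x -> Z x = x -> x = 0].
Proof.
pose P n := `[< exists A, size A = n /\ exists x, [/\ fixed A x, Z x = x & x <> 0] >].
have [n Pn] : exists n, P n.
  have [X [x xP]] := exists_fixed.
  by exists (size X); apply/asboolP; exists X; split=> //; exists x.
case: (ex_minnP (ex_intro _ n Pn)) => {n Pn} n /asboolP[A [An [x xP]]] nmin.
have Amin B y : (size B < size A)%N -> fixed B y -> Z y = y -> y = 0.
  move=> BA yB Zy; apply: contrapT => y0.
  have : (n <= size B)%N.
    by apply: nmin; apply/asboolP; exists B; split=> //; exists y.
  by rewrite -An leqNgt BA.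
exists A; split=> //; last by exists x.
apply: contrapT => /negP Au; have [xA Zx] := xP; apply.
apply: (Amin (undup A)) => //; first by rewrite ltn_size_undup.
move=> g gA; apply: xA => u uA; apply: gA; by rewrite mem_undup.
Qed.

Section Corner.
Variables (A : seq U) (p : H -> H).
Hypotheses (Auniq : uniq A)
  (Amin : forall B x, (size B < size A)%N -> fixed B x -> Z x = x -> x = 0)
  (pP : orthogonal_projection (fixed A) p).

Let Mp : M p. Proof. exact: proj_fixed_M pP. Qed.
Let P := Z \o p.

Let Vs := subspace_fixed A.

Let lp : linear p. Proof. exact: M_linear. Qed.
Let pp x : p (p x) = p x.
Proof. by apply: (proj_id Vs pP); exact: (pP x).1. Qed.
Let pZ x : p (Z x) = Z (p x). Proof. by rewrite ZC. Qed.

Let MP : M P. Proof. exact: commutant_comp. Qed.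
Let lP : linear P. Proof. exact: M_linear. Qed.
Let PP x : P (P x) = P x.
Proof. by rewrite /P /= pZ ZZ pp. Qed.
Let P_sa : self_adjoint P.
Proof. by move=> x y; rewrite /P /= Z_sa (proj_self_adjoint pP) pZ. Qed.
Let ZP x : Z (P x) = P x. Proof. by rewrite /P /= ZZ. Qed.
Let fixedP x : fixed A (P x). Proof. by rewrite /P /= -pZ; exact: (pP _).1. Qed.
Let P_id x : fixed A x -> Z x = x -> P x = x.
Proof. by move=> xA Zx; rewrite /P /= (proj_id Vs pP). Qed.

Definition permutes g := {in A, forall a, isom_fun g a \in A}.

Let isomK g u : isom_fun g^-1%g (isom_fun g u) = u.
Proof. by apply: (@isom_fun_inj _ _ g); rewrite isom_inv_funK. Qed.

Lemma permutes_surj g : permutes g -> {subset A <= map (isom_fun g) A}.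
Proof.
move=> gA; have gAA : {subset map (isom_fun g) A <= A}.
  by move=> _ /mapP[a aA ->]; exact: gA.
have gu : uniq (map (isom_fun g) A) by rewrite map_inj_uniq //; exact: isom_fun_inj.
have [|_ e] := uniq_min_size gu gAA; first by rewrite size_map.
by move=> a; rewrite e.
Qed.

Lemma surj_permutes g : {subset A <= map (isom_fun g) A} -> permutes g.
Proof.
move=> gA a aA; have [|_ e] := uniq_min_size Auniq gA; first by rewrite size_map.
by rewrite e map_f.
Qed.

Lemma permutesV g : permutes g -> permutes g^-1%g.
Proof.
by move=> /permutes_surj gA a /gA/mapP[b bA ->]; rewrite isomK.
Qed.

Lemma permutesM g h : permutes g -> permutes h -> permutes (g * h)%g.
Proof.
move=> gA hA a aA; rewrite -[isom_fun _ a]/(isom_fun g (isom_fun h a)).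
by apply: gA; exact: hA.
Qed.

Lemma fixed_permutes g x : permutes g -> fixed A x -> fixed A (pi g x).
Proof.
move=> gA xA k kA; rewrite -pi_mul; apply: (fixed_agree pi1 piM xA) => a aA.
by rewrite -[LHS]/(isom_fun k (isom_fun g a)) kA // gA.
Qed.

Lemma P_pi g x : permutes g -> P (pi g x) = pi g (P x).
Proof.
move=> gA; rewrite /P /= -[RHS](ZC _ (M_pi g)); congr Z.
apply: (proj_commute Vs pP) => // [y|y yo v vA]; first exact: fixed_permutes.
by rewrite pi_adj yo //; apply: fixed_permutes => //; exact: permutesV.
Qed.

(** For g not permuting A, the sets A and g A meet in fewer points than A has, so
that the fixed vector in the hull of the orbit of y is 0 by minimality of A. *)
Lemma compression0 g x : ~ permutes g -> P (pi g (P x)) = 0.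
Proof.
move=> gA; set y := P _; apply: sqnorm_eq0.
rewrite /sqnorm /rdot {1}/y P_sa [P y]PP.
rewrite -[complex.Re _]/(rdot _ _) rdotC.
have yA : fixed A y by exact: fixedP.
have gB : fixed (map (isom_fun g) A) (pi g (P x)).
  move=> k kA; rewrite -pi_mul; apply: (fixed_agree pi1 piM (fixedP x)) => a aA.
  by rewrite -[LHS]/(isom_fun k (isom_fun g a)) kA // map_f.
apply: (orthogonal_fixed Dset Uurysohn piU pi1 piM yA gB).
set C := [seq _ <- _ | _].
have [m mC hm] := fixed_hull C y.
suff -> : 0 = m by [].
rewrite (Amin _ mC) //; last exact: (hull_in_Z (ZP _) hm).
rewrite size_filter ltn_neqAle count_size andbT -all_count.
by apply/negP => /allP; exact: contra_not (@surj_permutes g) gA.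
Qed.

Lemma finite_representatives A' (B : seq U) : exists r : seq G, forall g,
  {in A', forall a, isom_fun g a \in B} ->
  exists2 k, k \in r & {in A', isom_fun k =1 isom_fun g}.
Proof.
elim: A' => [|a A' [r rP]].
  by exists [:: 1%g] => g _; exists 1%g; rewrite ?mem_head.
pose ok k b (g : G) := {in A', isom_fun g =1 isom_fun k} /\ isom_fun g a = b.
have /choice[f fP] : forall kb : G * U, exists h,
    (exists g, ok kb.1 kb.2 g) -> ok kb.1 kb.2 h.
  move=> kb; have [[g gP]|no] := pselect (exists g, ok kb.1 kb.2 g).
    by exists g.
  by exists 1%g.
exists [seq f (k, b) | k <- r, b <- B] => g gB.
have [|k kr kg] := rP g; first by move=> c cA; apply: gB; rewrite inE cA orbT.
exists (f (k, isom_fun g a)).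
  by apply/allpairsP; exists (k, isom_fun g a); rewrite kr gB ?mem_head.
have [] := fP (k, isom_fun g a).
  by exists g; split=> // c cA; rewrite kg.
move=> fk fa c; rewrite inE => /predU1P[->//|cA].
by rewrite fk // kg.
Qed.

Lemma permuting_representatives : exists r : seq G,
  (forall k, k \in r -> permutes k) /\
  forall g, permutes g -> exists2 k, k \in r & forall x, pi k (P x) = pi g (P x).
Proof.
have [r rP] := finite_representatives A A.
exists [seq k <- r | `[< permutes k >]]; split.
  by move=> k; rewrite mem_filter => /andP[/asboolP].
move=> g gA; have [k kr kg] := rP g gA.
exists k; last by move=> x; exact: (fixed_agree pi1 piM (fixedP x)).
rewrite mem_filter kr andbT; apply/asboolP => a aA; rewrite kg //; exact: gA.
Qed.

Section Algebra.
Variable r : seq G.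
Hypotheses (r_perm : forall k, k \in r -> permutes k)
  (r_rep : forall g, permutes g ->
     exists2 k, k \in r & forall x, pi k (P x) = pi g (P x)).

(** The span of the operators pi(k) P, k in r: as r represents all permutations
of A induced by isometries, it contains pi(g) P for every g permuting A. *)
Definition corner_algebra : set (H -> H) := [set T |
  exists c : 'I_(size r) -> R[i], forall x,
    T x = \sum_i c i *: pi (nth 1%g r i) (P x)].

Let B := corner_algebra.

Lemma corner_algebra_pi g : permutes g -> B (fun x => pi g (P x)).
Proof.
move=> /r_rep[k kr kg]; exists (fun i => (i == index k r :> nat)%:R) => x.
have ik : (index k r < size r)%N by rewrite index_mem.
rewrite (bigD1 (Ordinal ik)) //= eqxx scale1r nth_index // kg big1 ?addr0 //.
by move=> i /negPf ik'; rewrite -[_ == _ :> nat]/(i == Ordinal ik) ik' scale0r.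
Qed.

Lemma corner_algebra_lin c S T : B S -> B T -> B (fun x => c *: S x + T x).
Proof.
move=> [a aS] [b bT]; exists (fun i => c * a i + b i) => x.
rewrite aS bT scaler_sumr -big_split /=.
by apply: eq_bigr => i _; rewrite scalerDl scalerA.
Qed.

Lemma corner_algebra0 : B (fun=> 0).
Proof.
by exists (fun=> 0) => x; rewrite big1 // => i _; rewrite scale0r.
Qed.

Lemma corner_algebra_sum n (c : 'I_n -> R[i]) (T : 'I_n -> H -> H) :
  (forall i, B (T i)) -> B (fun x => \sum_i c i *: T i x).
Proof.
elim: n c T => [|n IH] c T BT.
  have := corner_algebra0; congr B; apply/funext => x; by rewrite big_ord0.
have := corner_algebra_lin (c ord0) (BT ord0)
  (IH (c \o lift ord0) _ (fun i => BT (lift ord0 i))).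
by congr B; apply/funext => x; rewrite big_ord_recl.
Qed.

Lemma corner_algebra_rep (i : 'I_(size r)) : permutes (nth 1%g r i).
Proof. by apply: r_perm; exact: mem_nth. Qed.

Lemma corner_algebra_M T : B T -> M T.
Proof.
move=> [c cT].
have -> : T = (fun x => \sum_i c i *: pi (nth 1%g r i) (P x)) by apply/funext.
apply: commutant_sum => [|i]; first exact: commutant_pi_linear.
exact: (commutant_comp (M_pi _) MP).
Qed.

Lemma corner_algebra_P T x : B T -> P (T x) = T x.
Proof.
move=> [c ->]; rewrite (linear_op_sum _ lP); apply: eq_bigr => i _.
by rewrite (linear_opZ lP) P_pi ?PP //; exact: corner_algebra_rep.
Qed.

Lemma corner_algebra_Z T x : B T -> Z (T x) = T x.
Proof. by move=> BT; rewrite -(corner_algebra_P x BT) ZP. Qed.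

Lemma star_corner_algebra : star_algebra B.
Proof.
split.
- by move=> T /corner_algebra_M/M_linear.
- exact: corner_algebra_lin.
- move=> S T [c cS] BT.
  have -> : S \o T = (fun x => \sum_i c i *: pi (nth 1%g r i) (P (T x))).
    by apply/funext => x /=; rewrite cS.
  apply: (@corner_algebra_sum _ c (fun i x => pi (nth 1%g r i) (P (T x)))) => i.
  case: BT => b bT.
  have -> : (fun x => pi (nth 1%g r i) (P (T x))) =
      (fun x => \sum_j b j *: pi (nth 1%g r i * nth 1%g r j)%g (P x)).
    apply/funext => x; rewrite bT (linear_op_sum _ lP) (linear_op_sum _ (pi_lin _)).
    apply: eq_bigr => j _; rewrite (linear_opZ lP) (linear_opZ (pi_lin _)).
    by rewrite P_pi ?PP ?pi_mul //; exact: corner_algebra_rep.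
  apply: corner_algebra_sum => j; apply: corner_algebra_pi.
  by apply: permutesM; exact: corner_algebra_rep.
- move=> T [c cT].
  exists (fun x => \sum_i (c i)^* *: pi (nth 1%g r i)^-1%g (P x)).
    apply: corner_algebra_sum => i; apply: corner_algebra_pi.
    by apply: permutesV; exact: corner_algebra_rep.
  move=> x y; rewrite cT dot_sumr dotC dot_sumr rmorph_sum /=.
  apply: eq_bigr => i _; rewrite !dotZl rmorphM /= conjCK; congr (_ * _).
  rewrite -dotC pi_adj P_sa P_pi //; apply: permutesV; exact: corner_algebra_rep.
Qed.

Lemma minimal_corner_projection : (exists x, [/\ fixed A x, Z x = x & x <> 0]) ->
  exists q, [/\ B q, q \o q = q, self_adjoint q, ~ (forall x, q x = 0) &
    minimal_in B q].
Proof.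
move=> [x [xA Zx x0]].
have BP : B P.
  have := @corner_algebra_pi 1%g (fun a aA => aA); congr B.
  by apply/funext => y; rewrite pi1.
apply: (minimal_projection_below star_corner_algebra BP) => //.
- by apply/funext => y; exact: PP.
- by move=> /(_ x); rewrite P_id.
- move=> t tB; apply: span_dependent => i; have [[c cT] _ _] := tB i.
  exists c; exact: cT.
Qed.

(** Write eta for q x.  The projection onto the closed span V of the orbit of eta
commutes with pi, so T preserves V.  Since q pi(g) q is a multiple of q for every
g, the operator q maps the orbit of eta, hence V, into the multiples of eta. *)
Lemma minimal_abelian q : B q -> q \o q = q -> self_adjoint q ->
  minimal_in B q -> forall T x, M T -> exists c, q (T (q x)) = c *: q x.
Proof.
move=> Bq qq q_sa qmin T x MT; set eta := q x.
have lq : linear q := M_linear (corner_algebra_M Bq).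
have qP y : q (P y) = q y.
  have [c cq] := Bq; rewrite !cq; apply: eq_bigr => i _.
  by rewrite PP.
have qqE y : q (q y) = q y by rewrite -[LHS]/((q \o q) y) qq.
have Pq y : P (q y) = q y by exact: corner_algebra_P.
have qpi g : exists c, q (pi g eta) = c *: eta.
  have [gA|gA] := pselect (permutes g).
    have [c cq] := qmin _ (corner_algebra_pi gA).
    by exists c; rewrite -cq /eta Pq.
  by exists 0; rewrite scale0r -qP /eta -(Pq x) compression0 // linear_op0.
pose V v := forall W : set H, linear_subspace W -> norm_closed W ->
  (forall g, W (pi g eta)) -> W v.
have Vsub : linear_subspace V.
  split=> [W [] //|a v w Vv Vw W Ws Wc We]; apply: Ws.2; [exact: Vv|exact: Vw].
have Vcl : norm_closed V.
  move=> v vP W Ws Wc We; apply: (Wc) => e /vP[w Vw vw].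
  by exists w => //; exact: Vw.
have Vpi g v : V v -> V (pi g v).
  move=> Vv W Ws Wc We; apply: (Vv (pi g @^-1` W)).
  - split=> [|a u w] /=; first by rewrite (linear_op0 (pi_lin g)); exact: Ws.1.
    by rewrite (linear_opD (pi_lin g)) (linear_opZ (pi_lin g)); exact: Ws.2.
  - have /bounded_operatorP[lg cg] := pi_bounded g; exact: norm_closed_preimage.
  - by move=> h /=; rewrite -pi_mul; exact: We.
have [pV pVP] := projection_exists Vsub Vcl.
have CpV : commutant (range pi) pV.
  split; first exact: (proj_bounded Vsub pVP).
  move=> _ [g _ <-]; apply/funext => v /=.
  apply: (proj_commute Vsub pVP) => // [w|w wo u Vu]; first exact: Vpi.
  by rewrite pi_adj wo //; exact: Vpi.
have Veta : V eta by move=> W _ _ We; rewrite -[eta](pi1E pi1); exact: We.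
have VT : V (T eta).
  rewrite -(proj_id Vsub pVP Veta) (commutant_comm _ MT CpV).
  exact: (pVP _).1.
(* [W] is the set of all [v] such that [q v] is a multiple of [eta], written as a
   double orthogonal in order to be visibly closed. *)
pose W := [set v | forall f, '[f, eta] = 0 -> '[v, q f] = 0].
have WT : W (T eta).
  apply: VT.
  - split=> [f _|a v w Wv Ww f fe]; first by rewrite dot0l.
    by rewrite dotDl dotZl Wv // Ww // mulr0 addr0.
  - move=> v vP f fe; apply: norm_closed_orthogonal => e /vP[w Ww vw].
    by exists w => //; exact: Ww.
  - move=> g f fe; rewrite -q_sa; have [c ->] := qpi g.
    by rewrite dotZl dotC fe rmorph0 mulr0.
have [eta0|eta0] := pselect (eta = 0).
  exists 0; rewrite eta0 scaler0 (linear_op0 (M_linear MT)) linear_op0 //.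
pose c := '[q (T eta), eta] / '[eta, eta].
exists c; apply/eqP; rewrite -subr_eq0; apply/eqP; set f := _ - _.
have ee : '[eta, eta] != 0 by apply/eqP => /dot_eq0.
have fe : '[f, eta] = 0 by rewrite /f dotBl dotZl /c divfK // subrr.
apply: dot_eq0; rewrite {1}/f dotBl dotZl [X in _ - c * X]dotC fe rmorph0 mulr0.
by rewrite subr0 q_sa WT.
Qed.

End Algebra.

End Corner.

End Central.

End VonNeumann.

(** * Isometry groups are of type I *)

Lemma nbhs1_stab (R : realType) (U : metricType R) (N : set (Isom U)) :
  nbhs (1%g : Isom U) N -> exists X : seq U, @stab R U X `<=` N.
Proof.
move=> [? /= [[W oW <-]] /= W1 WN].
pose F : set_system (Isom U) := [set N | exists X : seq U, @stab R U X `<=` N].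
have FF : Filter F.
  split=> [|S T [X XS] [Y YT]|S T ST [X XS]].
  - by exists [::].
  - exists (X ++ Y) => g gXY; split; [apply: XS|apply: YT] => u uX; apply: gXY.
      exact: mem_cat_l.
    exact: mem_cat_r.
  - by exists X; exact: subset_trans ST.
suff Fcvg : (set_val : Isom U -> {ptws discrete_topology U -> discrete_topology U}) @ F
    --> (set_val (1%g : Isom U) : {ptws discrete_topology U -> discrete_topology U}).
  have [X XW] : F (set_val @^-1` W) by apply: Fcvg; exact: open_nbhs_nbhs.
  by exists X; exact: subset_trans WN.
apply/(@pointwise_cvgP (discrete_topology U) (discrete_topology U)) => u.
apply/discrete_cvg; exists [:: u] => g gu.
by apply: gu; rewrite mem_head.
Qed.

Lemma representation_near1 (R : realType) (U : metricType R) (H : hilbertType R)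
    (pi : Isom U -> {ptws H -> H}) : unitary_representation pi ->
  forall (x : H) (e : R), 0 < e ->
    exists X : seq U, forall g, stab X g -> sqnorm ((pi g : H -> H) x - x) < e.
Proof.
move=> [_ pi1 _ piC] x e e0.
have piC1 : pi @ nbhs (1%g : Isom U) --> pi 1%g := piC 1%g.
have FF : Filter (pi @ nbhs (1%g : Isom U)) by exact: fmap_filter.
have cx : (fun g => (pi g : H -> H) x) @ nbhs (1%g : Isom U) --> x.
  by have := (@pointwise_cvgP _ _ _ _ FF).1 piC1 x; rewrite pi1.
have [d d0 de] := sqr_le_exists e0.
have dC : 0 < d%:C by rewrite ltcR.
have near1 := (@cvgrPdist_lt _ _ _ _ _ _ _).1 cx d%:C dC.
have [X XP] := nbhs1_stab (near1 (nbhs_filter _)).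
exists X => g gX; rewrite sqnorm_distC; apply: lt_le_trans de.
by rewrite sqnorm_lt_norm //; exact: XP.
Qed.

Theorem corollary1p2 (R : realType) (Delta : set R) (U : metricType R) :
  distance_set Delta -> urysohn_space Delta U -> type_I_group R (Isom U).
Proof.
move=> Dset Uury H pi pirep Z Zc Z0.
have piC := representation_near1 pirep.
have [piU pi1 piM _] := pirep.
have [A [Au Ax Amin]] := exists_minimal_fixed piU pi1 piM piC Zc Z0.
have [p pP] := projection_exists (subspace_fixed piU A)
  (norm_closed_fixed (X := A) piU).
have [r [r_perm r_rep]] := permuting_representatives piU pi1 piM Zc pP.
have [q [Bq qq q_sa q0 qmin]] :=
  minimal_corner_projection piU pi1 piM Zc Au pP r_perm r_rep Ax.
have Mq := corner_algebra_M piU pi1 piM Zc pP Bq.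
exists q; split.
- split; first by split.
  move=> S T MS MT.
  have ab V x := minimal_abelian Dset Uury piU pi1 piM Zc Au
    Amin pP r_perm r_rep Bq qq q_sa qmin (T := V) x.
  apply/funext => x /=.
  have qqE y : q (q y) = q y by rewrite -[LHS]/((q \o q) y) qq.
  have lq : linear q := M_linear Mq.
  have [a aS] := ab S x MS; have [b bT] := ab T x MT.
  rewrite !qqE aS bT (linear_opZ (M_linear MS)) (linear_opZ (M_linear MT)).
  by rewrite !(linear_opZ lq) aS bT !scalerA mulrC.
- by move=> q0'; apply: q0 => x; rewrite q0'.
- by apply/funext => x /=; rewrite (corner_algebra_Z piU pi1 piM Zc Au pP r_perm x Bq).
Qed.
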